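(* Let $A$ be a separable unital $C^*$-algebra, let $n\in\mathbb{N}$, and let $\alpha\colon\mathbb{T}\to\mathrm{Aut}(A)$ be an action with the Rokhlin property. Suppose that $A$ absorbs $M_{n^\infty}$, i.e. $A\otimes M_{n^\infty}\cong A$. Then the restriction $\alpha|_n\colon\mathbb{Z}_n\to\mathrm{Aut}(A)$ has the Rokhlin property (as an action of the finite group $\mathbb{Z}_n$).
   Context: $\mathbb{N}=\{1,2,\ldots\}$; $\mathbb{T}$ is the circle group, identified with the complex numbers of modulus $1$; actions are continuous. $M_{n^\infty}$ is the UHF-algebra $\bigotimes_{k=1}^\infty M_n(\mathbb{C})$. The group $\mathbb{Z}_n$ is identified with the $n$-th roots of unity $\{1,e^{2\pi i/n},\ldots,e^{2\pi i(n-1)/n}\}\subseteq\mathbb{T}$, and $\alpha|_n$ is the restriction of $\alpha$ to this subgroup. Rokhlin property for circle actions: a continuous action $\alpha\colon\mathbb{T}\to\mathrm{Aut}(A)$ on a unital $C^*$-algebra has the Rokhlin property if for every finite $F\subseteq A$ and every $\varepsilon>0$ there is a unitary $u\in A$ with $\|\alpha_\zeta(u)-\zeta u\|<\varepsilon$ for all $\zeta\in\mathbb{T}$ and $\|ua-au\|<\varepsilon$ for all $a\in F$. Rokhlin property for finite groups: an action $\beta\colon G\to\mathrm{Aut}(A)$ of a finite group $G$ on a unital $C^*$-algebra has the Rokhlin property if for every $\varepsilon>0$ and every finite $F\subseteq A$ there are orthogonal projections $e_g\in A$, $g\in G$, with $\|\beta_g(e_h)-e_{gh}\|<\varepsilon$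 for all $g,h\in G$, $\|e_ga-ae_g\|<\varepsilon$ for all $g\in G$, $a\in F$, and $\sum_{g\in G}e_g=1$. *)

(* Defs.v *)
From HB Require Import structures.
From mathcomp Require Import all_boot all_order all_algebra all_fingroup.
From mathcomp Require Import complex.
From mathcomp Require Import all_classical all_reals all_analysis.

Set Implicit Arguments.
Unset Strict Implicit.
Unset Printing Implicit Defensive.

Import Order.TTheory GRing.Theory Num.Theory.
Import numFieldNormedType.Exports.

Local Open Scope classical_set_scope.
Local Open Scope complex_scope.
Local Open Scope ring_scope.

(* Unital C*-algebras. MathComp has no join of the ring and the normed module
   hierarchies below numDomainType, so the product is part of the mixin and the
   ring structure is declared on the carrier afterwards. The zero algebra is
   allowed, hence pzRingType. *)
HB.mixin Record isCStarAlgebra (R : realType) A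
    of CompleteNormedModule R[i] A := {
  cone : A;
  cmul : A -> A -> A;
  star : A -> A;
  cmulA : associative cmul;
  cmul1x : left_id cone cmul;
  cmulx1 : right_id cone cmul;
  cmulDl : left_distributive cmul +%R;
  cmulDr : right_distributive cmul +%R;
  cmulZl : forall (c : R[i]) x y, cmul (c *: x) y = c *: cmul x y;
  cmulZr : forall (c : R[i]) x y, cmul x (c *: y) = c *: cmul x y;
  starK : involutive star;
  starD : {morph star : x y / x + y};
  starZ : forall (c : R[i]) x, star (c *: x) = c^* *: star x;
  starM : forall x y, star (cmul x y) = cmul (star y) (star x);
  cmul_norm : forall x y, `|cmul x y| <= `|x| * `|y|;
  cstar_norm : forall x, `|cmul (star x) x| = `|x| ^+ 2
}.

#[short(type="cstarType")]
HB.structure Definition CStarAlgebra (R : realType) :=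
  {A of CompleteNormedModule R[i] A & isCStarAlgebra R A}.

HB.instance Definition _ (R : realType) (A : cstarType R) :=
  GRing.Zmodule_isPzRing.Build A
    (@cmulA R A) (@cmul1x R A) (@cmulx1 R A) (@cmulDl R A) (@cmulDr R A).

Section StarHom.
Context {R : realType}.

Definition star_hom (A B : cstarType R) (f : A -> B) : Prop :=
  [/\ linear f, f 1 = 1, {morph f : x y / x * y} & {morph f : x / star x}].

(* The same for maps out of the *-algebra M_n(C), which is given no norm
   here. *)
Definition mx_star_hom (n : nat) (B : cstarType R) (f : 'M[R[i]]_n -> B) :
    Prop :=
  [/\ linear f, f 1%:M = 1, {morph f : x y / x *m y >-> x * y} &
      forall x, f (x ^t* )%sesqui = star (f x)].

Definition star_isomorphic (A B : cstarType R) : Prop :=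
  exists f : A -> B, star_hom f /\ bijective f.

Definition unitary (A : cstarType R) (u : A) : Prop :=
  star u * u = 1 /\ u * star u = 1.

Definition projection (A : cstarType R) (p : A) : Prop :=
  p * p = p /\ star p = p.

End StarHom.

Definition separable_space (T : topologicalType) : Prop :=
  exists2 S : set T, countable S & dense S.

Section Tensor.
Context {R : realType}.

Definition lin_indep (V : lmodType R[i]) (m : nat) (v : 'I_m -> V) : Prop :=
  forall c : 'I_m -> R[i], \sum_i c i *: v i = 0 -> forall i, c i = 0.

(* iA and iB induce an injective unital *-homomorphism a (x) b |-> iA a * iB b
   from the algebraic tensor product of A and B into E; the norms
   pulled back along such pairs are the C*-norms of the tensor product. *)
Definition tensor_rep (A B E : cstarType R)
    (iA : A -> E) (iB : B -> E) : Prop :=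
  [/\ star_hom iA, star_hom iB,
      forall a b, iA a * iB b = iB b * iA a &
      forall (m : nat) (a : 'I_m -> A) (b : 'I_m -> B),
        lin_indep b -> \sum_i iA (a i) * iB (b i) = 0 -> forall i, a i = 0].

(* D is the minimal (spatial) C*-tensor product of A and B: the completion of
   the algebraic tensor product in its smallest C*-norm. *)
Definition is_cstar_tensor (A B D : cstarType R) : Prop :=
  exists (iA : A -> D) (iB : B -> D),
    [/\ tensor_rep iA iB,
        dense [set d | exists (m : nat) (a : 'I_m -> A) (b : 'I_m -> B),
                 d = \sum_i iA (a i) * iB (b i)] &
        forall (E : cstarType R) (jA : A -> E) (jB : B -> E),
          tensor_rep jA jB ->
          forall (m : nat) (a : 'I_m -> A) (b : 'I_m -> B),
            `|\sum_i iA (a i) * iB (b i)| <= `|\sum_i jA (a i) * jB (b i)|].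

(* U is the infinite C*-tensor product of copies of M_n(C): iota k is the
   inclusion of the k-th factor. The last two clauses say that the algebraic
   infinite tensor product, spanned by the finite elementary tensors, embeds in
   U with dense range; its C*-norm is unique, as it is on matrix algebras. *)
Definition is_UHF (n : nat) (U : cstarType R) : Prop :=
  exists iota : nat -> 'M[R[i]]_n -> U,
    [/\ forall k, mx_star_hom (iota k),
        forall k l x y, k <> l -> iota k x * iota l y = iota l y * iota k x,
        forall (m : nat) (c : {ffun 'I_m -> 'I_n * 'I_n} -> R[i]),
          \sum_f c f *: (\prod_(k < m) iota k (delta_mx (f k).1 (f k).2)) = 0 ->
          forall f, c f = 0 &
        dense [set u | exists (m p : nat) (x : 'I_p -> 'I_m -> 'M[R[i]]_n),
                 u = \sum_(j < p) \prod_(k < m) iota k (x j k)]].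

Definition absorbs_UHF (n : nat) (A : cstarType R) : Prop :=
  exists U D : cstarType R,
    [/\ is_UHF n U, is_cstar_tensor A U D & star_isomorphic D A].

End Tensor.

Section Circle.
Variable R : realType.

Definition circle_set : set (R[i])^o := [set z | `|z| = 1].
Definition circle : Type := set_type circle_set.
HB.instance Definition _ := Choice.copy circle (set_type circle_set).
HB.instance Definition _ := Topological.copy circle (set_type circle_set).

Definition cval (z : circle) : R[i] := set_val z.
Lemma cval_inj : injective cval. Proof. exact: val_inj. Qed.
Lemma cval_norm (z : circle) : `|cval z| = 1.
Proof. by have := set_valP z. Qed.
Definition Circle (z : R[i]) (h : `|z| = 1) : circle :=
  exist _ (z : (R[i])^o) (mem_set h).
Lemma CircleK z h : cval (@Circle z h) = z. Proof. by []. Qed.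

Lemma circle1_subproof : `|1 : R[i]| = 1. Proof. exact: normr1. Qed.
Lemma circleM_subproof (x y : circle) : `|cval x * cval y| = 1.
Proof. by rewrite normrM !cval_norm mulr1. Qed.
Lemma circleV_subproof (x : circle) : `|(cval x)^-1| = 1.
Proof. by rewrite normfV cval_norm invr1. Qed.
Definition circle_one := Circle circle1_subproof.
Definition circle_mul x y := Circle (circleM_subproof x y).
Definition circle_inv x := Circle (circleV_subproof x).
Lemma circle_mulA : associative circle_mul.
Proof. by move=> x y z; apply: cval_inj; rewrite !CircleK mulrA. Qed.
Lemma circle_mul1 : left_id circle_one circle_mul.
Proof. by move=> x; apply: cval_inj; rewrite !CircleK mul1r. Qed.
Lemma circle_1mul : right_id circle_one circle_mul.
Proof. by move=> x; apply: cval_inj; rewrite !CircleK mulr1. Qed.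
Lemma cval_neq0 (x : circle) : cval x != 0.
Proof. by rewrite -normr_eq0 cval_norm oner_eq0. Qed.
Lemma circle_mulV : left_inverse circle_one circle_inv circle_mul.
Proof. by move=> x; apply: cval_inj; rewrite !CircleK mulVf// cval_neq0. Qed.
Lemma circle_Vmul : right_inverse circle_one circle_inv circle_mul.
Proof. by move=> x; apply: cval_inj; rewrite !CircleK mulfV// cval_neq0. Qed.
HB.instance Definition _ := isGroup.Build circle
  circle_mulA circle_mul1 circle_1mul circle_mulV circle_Vmul.

Definition cis (t : R) : R[i] := cos t +i* sin t.

Lemma cisD s t : cis (s + t) = cis s * cis t.
Proof. by rewrite /cis cosD sinD; simpc; rewrite [_ + sin s * _]addrC. Qed.

Lemma norm_cis t : `|cis t| = 1.
Proof. by rewrite normc_def /= cos2Dsin2 sqrtr1. Qed.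

Lemma cis_2pin (m : nat) : cis (2 * pi * m%:R) = 1.
Proof.
elim: m => [|m IH]; first by rewrite mulr0 /cis cos0 sin0.
rewrite -[m.+1%:R]natr1 mulrDr mulr1 cisD IH mul1r /cis.
by rewrite mulr_natl cos2pi sin2pi.
Qed.

(* k |-> e^(2 pi i k / n), identifying Z_n with the n-th roots of unity. For
   n > 0 the additive group 'I_n.-1.+1 is Z_n ('Z_1 would be Z/2). *)
Definition nth_root (n : nat) (k : 'I_n.-1.+1) : circle :=
  Circle (norm_cis (2 * pi * (k%:R / n%:R))).

Lemma nth_rootM n :
  {morph @nth_root n : k l / (k * l)%g >-> (k * l)%g}.
Proof.
move=> k l; apply: cval_inj; rewrite !CircleK -cisD -mulrDr -mulrDl.
case: n k l => [|n] k l; first by rewrite invr0 !mulr0.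
rewrite -natrD [in RHS](divn_eq (k + l) n.+1) natrD natrM.
rewrite [(_ + _) / n.+1%:R]mulrDl mulfK ?pnatr_eq0//.
by rewrite [in RHS]mulrDr cisD cis_2pin mul1r.
Qed.

End Circle.

Section Actions.
Context {R : realType}.

Record cstar_action (G : groupType) (A : cstarType R) := CStarAction {
  act :> G -> A -> A;
  act_star_hom : forall g, star_hom (act g);
  act1 : forall a, act 1%g a = a;
  actM : forall g h a, act (g * h)%g a = act g (act h a)
}.

Definition continuous_action (A : cstarType R)
    (alpha : cstar_action (circle R) A) : Prop :=
  forall a : A, continuous (fun zeta : circle R => alpha zeta a).

Section Pullback.
Variables (G H : groupType) (f : H -> G).
Hypothesis fM : {morph f : x y / (x * y)%g}.
Variables (A : cstarType R) (alpha : cstar_action G A).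

Lemma pullback_act1 a : alpha (f 1%g) a = a.
Proof.
suff -> : f 1%g = 1%g by rewrite act1.
by apply: (@mulgI _ (f 1%g)); rewrite -fM !mulg1.
Qed.

Lemma pullback_actM g h a : alpha (f (g * h)%g) a = alpha (f g) (alpha (f h) a).
Proof. by rewrite fM actM. Qed.

Definition pullback_action : cstar_action H A :=
  CStarAction (fun g => act_star_hom alpha (f g)) pullback_act1 pullback_actM.
End Pullback.

Definition restrict_Zn (n : nat) (A : cstarType R)
    (alpha : cstar_action (circle R) A) : cstar_action 'I_n.-1.+1 A :=
  pullback_action (@nth_rootM R n) alpha.

(* In the order of R[i], 0 < eps forces eps to be real. *)
Definition rokhlin_circle (A : cstarType R)
    (alpha : cstar_action (circle R) A) : Prop :=
  forall (F : set A) (eps : R[i]), finite_set F -> 0 < eps ->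
  exists u : A,
    [/\ unitary u,
        forall zeta, `|alpha zeta u - cval zeta *: u| < eps &
        forall a, F a -> `|u * a - a * u| < eps].

Definition rokhlin_finite (G : finGroupType) (A : cstarType R)
    (beta : cstar_action G A) : Prop :=
  forall (F : set A) (eps : R[i]), finite_set F -> 0 < eps ->
  exists e : G -> A,
    [/\ (forall g, projection (e g)) /\ (forall g h, g <> h -> e g * e h = 0),
        forall g h, `|beta g (e h) - e (g * h)%g| < eps,
        forall g a, F a -> `|e g * a - a * e g| < eps &
        \sum_g e g = 1].

End Actions.

(* Main.v *)
From HB Require Import structures.
From mathcomp Require Import all_boot all_order all_algebra all_fingroup.
From mathcomp Require Import complex ring lra zify.
From mathcomp Require Import all_classical all_reals all_analysis.
Require Import Defs.

Set Implicit Arguments.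
Unset Strict Implicit.
Unset Printing Implicit Defensive.

Import Order.TTheory GRing.Theory Num.Theory.
Import numFieldNormedType.Exports.

Local Open Scope classical_set_scope.
Local Open Scope complex_scope.
Local Open Scope ring_scope.

(** The idea. Let w = exp(2 pi i / n) and v(z) = n^(-1/2) (1, z, ..., z^(n-1))
    for z on the circle. The vectors v(z), v(w z), ..., v(w^(n-1) z) are
    orthonormal, so the rank one projections p(z) = v(z) v(z)^* satisfy
    p(z) + p(w z) + ... + p(w^(n-1) z) = 1 with orthogonal summands. If A held
    matrix units e_jl fixed by the action and a unitary u commuting with them
    such that zeta sends u to zeta u, then
    p(u) = (1/n) sum_jl u^(j-l) e_jl and its translates would be the
    projections that the finite group needs.

    Absorption of the UHF-algebra gives matrix units that almost commute with
    any finite set ([central_mxunits]), but the action moves them. They are made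
    invariant by letting them depend on z as well: with phi : M_n -> A the
    embedding, P(z) = alpha_(1/z) (phi (p(z))) is a function on the circle for
    which alpha_(w^k) (P(w^k z)) = alpha_(1/z) (phi (p(w^k z))). Hence, for each
    z, the translates of P are an exact partition of unity into projections, and
    they almost commute with a given finite set if the matrix units almost
    commute with its orbit under the circle.

    It remains to replace z by a Rokhlin unitary u. The orbit maps are uniform
    limits of Laurent polynomials in z with coefficients in A
    ([approximable_orbit]: convolution with the de la Vallee-Poussin kernel,
    where the integral is a finite sum over roots of unity). So P is close to
    such a polynomial G, and G(u) makes sense. The unitary u is chosen after G,
    almost commuting with its coefficients; evaluation at u is then multiplicative,
    *-preserving and equivariant up to a small error. The point is that it is
    also almost contractive for the supremum norm on the circle
    ([symbol_norm]), so that all relations between the translates of P hold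
    for the translates of G(u) up to a small error. Finally, an approximate
    partition of unity into projections is close to an exact one
    ([partition_near]).

    All estimates are made with the real number [nrm x] in place of the norm,
    which is a nonnegative complex number. *)

(** * Norms and involution *)

Section RealNorm.
Context {R : realType}.

Definition nrm {V : normedZmodType R[i]} (x : V) : R := complex.Re `|x|.

Section Zmod.
Context {V : normedZmodType R[i]}.
Implicit Types x y : V.

Lemma nrmE x : `|x| = (nrm x)%:C.
Proof.
by rewrite /nrm; case: `|x| (normr_ge0 x) => a b /ger0_Im /= ->.
Qed.

Lemma nrm_ge0 x : 0 <= nrm x.
Proof. by rewrite -ler0c -nrmE. Qed.

Lemma nrm0 : nrm (0 : V) = 0.
Proof. by rewrite /nrm normr0. Qed.

Lemma nrm_eq0 x : nrm x = 0 -> x = 0.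
Proof. by move=> h; apply/normr0_eq0; rewrite nrmE h. Qed.

Lemma nrmN x : nrm (- x) = nrm x.
Proof. by rewrite /nrm normrN. Qed.

Lemma nrmB x y : nrm (x - y) = nrm (y - x).
Proof. by rewrite /nrm distrC. Qed.

Lemma nrmD x y : nrm (x + y) <= nrm x + nrm y.
Proof. by rewrite -lecR rmorphD /= -!nrmE ler_normD. Qed.

Lemma nrm_sum (I : Type) (r : seq I) (P : pred I) (F : I -> V) :
  nrm (\sum_(i <- r | P i) F i) <= \sum_(i <- r | P i) nrm (F i).
Proof.
elim/big_ind2: _ => [|x a y b hx hy|//]; first by rewrite nrm0.
by apply: le_trans (nrmD _ _) _; exact: lerD.
Qed.

Lemma nrm_sub_trans y x z : nrm (x - z) <= nrm (x - y) + nrm (y - z).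
Proof. by apply: le_trans (nrmD _ _); rewrite addrA subrK. Qed.

Lemma nrm_le_sub x y : nrm x <= nrm y + nrm (x - y).
Proof. by rewrite -{1}(subrK y x) addrC nrmD. Qed.
End Zmod.

Lemma nrmZ {V : normedModType R[i]} (c : R[i]) (x : V) :
  nrm (c *: x) = nrm c * nrm x.
Proof. by apply: complexI; rewrite rmorphM /= -!nrmE normrZ. Qed.

Lemma nrm_real (r : R) : nrm r%:C = `|r|.
Proof. by rewrite /nrm normc_def /= expr0n addr0 sqrtr_sqr. Qed.

Lemma nrm_circle (z : circle R) : nrm (cval z) = 1.
Proof. by apply: complexI; rewrite -nrmE cval_norm. Qed.

Lemma nrmCM (x y : R[i]) : nrm (x * y) = nrm x * nrm y.
Proof. by apply: complexI; rewrite rmorphM /= -!nrmE normrM. Qed.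

Lemma nrmCX (x : R[i]) k : nrm (x ^+ k) = nrm x ^+ k.
Proof. by apply: complexI; rewrite rmorphXn /= -!nrmE normrX. Qed.

Lemma nrmCJ (x : R[i]) : nrm (x^*)%R = nrm x.
Proof. by rewrite /nrm norm_conjC. Qed.

Lemma nrm1C : nrm (1 : R[i]) = 1.
Proof. by rewrite /nrm normr1. Qed.

Lemma conj_cval (z : circle R) : (cval z)^*%R = (cval z)^-1.
Proof.
by apply: (mulfI (cval_neq0 z)); rewrite -normCK cval_norm expr1n mulfV ?cval_neq0.
Qed.

End RealNorm.

Section CStar.
Context {R : realType} {A : cstarType R}.
Implicit Types x y : A.

Lemma csZl (c : R[i]) x y : (c *: x) * y = c *: (x * y).
Proof. exact: cmulZl. Qed.

Lemma csZr (c : R[i]) x y : x * (c *: y) = c *: (x * y).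
Proof. exact: cmulZr. Qed.

Lemma csZM (c d : R[i]) x y : (c *: x) * (d *: y) = (c * d) *: (x * y).
Proof. by rewrite csZl csZr scalerA. Qed.

Lemma csXZ (c : R[i]) x k : (c *: x) ^+ k = (c ^+ k) *: x ^+ k.
Proof.
elim: k => [|k IH]; first by rewrite !expr0 scale1r.
by rewrite !exprS IH csZM.
Qed.

Lemma csM x y : star (x * y) = star y * star x.
Proof. exact: starM. Qed.

Lemma star0 : star (0 : A) = 0.
Proof. by apply: (@addrI _ (star 0)); rewrite -starD !addr0. Qed.

Lemma starN x : star (- x) = - star x.
Proof. by apply: (@addrI _ (star x)); rewrite -starD !subrr star0. Qed.

Lemma starB x y : star (x - y) = star x - star y.
Proof. by rewrite starD starN. Qed.

Lemma star_sum (I : Type) (r : seq I) (P : pred I) (F : I -> A) :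
  star (\sum_(i <- r | P i) F i) = \sum_(i <- r | P i) star (F i).
Proof. by apply: (big_morph (@star R A)); [exact: starD|exact: star0]. Qed.

Lemma star1 : star (1 : A) = 1.
Proof. by rewrite -[LHS]mulr1 -{2}(starK (1 : A)) -csM mulr1 starK. Qed.

Lemma starX x k : star (x ^+ k) = star x ^+ k.
Proof.
elim: k => [|k IH]; first by rewrite !expr0 star1.
by rewrite exprS csM IH -exprSr.
Qed.

Lemma nrmM x y : nrm (x * y) <= nrm x * nrm y.
Proof. by rewrite -lecR rmorphM /= -!nrmE; exact: cmul_norm. Qed.

Lemma nrm_cstar x : nrm (star x * x) = nrm x ^+ 2.
Proof. by apply: complexI; rewrite rmorphXn /= -!nrmE; exact: cstar_norm. Qed.

Lemma nrm_star x : nrm (star x) = nrm x.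
Proof.
suff h y : nrm y <= nrm (star y).
  by apply/eqP; rewrite eq_le h andbT; have := h (star x); rewrite starK.
have := nrmM (star y) y; rewrite nrm_cstar expr2.
have [->|] := eqVneq (nrm y) 0; first by rewrite nrm_ge0.
move=> y0; rewrite ler_pM2r // lt_neqAle eq_sym y0 nrm_ge0 //.
Qed.

Lemma idem_nrm_le1 (a : R) : 0 <= a -> a ^+ 2 <= a -> a <= 1.
Proof. nra. Qed.

Lemma nrm_proj x : projection x -> nrm x ^+ 2 = nrm x.
Proof. by case=> xx sx; rewrite -nrm_cstar sx xx. Qed.

Lemma nrm_proj_le1 x : projection x -> nrm x <= 1.
Proof. by move=> /nrm_proj h; apply: idem_nrm_le1; rewrite ?nrm_ge0 ?h. Qed.

Lemma nrm_proj_lt1 x : projection x -> nrm x < 1 -> x = 0.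
Proof.
move=> /nrm_proj h l; apply: nrm_eq0; have := nrm_ge0 x; nra.
Qed.

Lemma projection1 : projection (1 : A).
Proof. by split; [rewrite mulr1|exact: star1]. Qed.

Lemma nrm1_le1 : nrm (1 : A) <= 1.
Proof. exact/nrm_proj_le1/projection1. Qed.

Lemma nrm_unitary u : unitary (u : A) -> nrm u <= 1.
Proof.
case=> uu _; have := nrm_cstar u; rewrite uu; have := nrm1_le1.
by have := nrm_ge0 u; nra.
Qed.

Lemma nrmX_le1 x k : nrm x <= 1 -> nrm (x ^+ k) <= 1.
Proof.
move=> h; elim: k => [|k IH]; first by rewrite expr0 nrm1_le1.
rewrite exprS; apply: le_trans (nrmM _ _) _.
by have := nrm_ge0 x; have := nrm_ge0 (x ^+ k); nra.
Qed.

Lemma nrmM_le x y a b : nrm x <= a -> nrm y <= b -> nrm (x * y) <= a * b.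
Proof.
move=> ha hb; apply: le_trans (nrmM _ _) _.
by apply: ler_pM => //; exact: nrm_ge0.
Qed.

End CStar.

(** * Convergence at a geometric rate *)

Section GeometricDecay.
Context {R : realType}.

Lemma bernoulli_decay (r : R) m :
  0 <= r <= 1 -> r ^+ m * (1 + m%:R * (1 - r)) <= 1.
Proof.
move=> /andP[r0 r1]; elim: m => [|m IH]; first by rewrite expr0 !mul0r addr0 mulr1.
apply: le_trans IH; rewrite exprSr -mulrA ler_wpM2l ?exprn_ge0 //.
rewrite -natr1; have := ler0n R m; set t := m%:R => t0.
have : 0 <= (t + 1) * (1 - r) ^+ 2 by rewrite mulr_ge0 ?sqr_ge0 //; lra.
by rewrite expr2; lra.
Qed.

(** Used with a geometric rate alone, and twice to see a linear factor (a
    number of roots of unity) lose against a power. *)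
Lemma linear_geometric_decay (q a b e : R) :
  0 <= q < 1 -> 0 <= a -> 0 <= b -> 0 < e ->
  exists M, forall m, (M <= m)%N -> (a * m%:R + b) * q ^+ m <= e.
Proof.
move=> /andP[q0 q1] a0 b0 e0; pose r := (1 + q) / 2; pose t := 1 - r.
have t0 : 0 < t by rewrite /t /r; lra.
have r01 : 0 <= r <= 1 by apply/andP; rewrite /r; split; lra.
have r0 : 0 <= r by case/andP: r01.
have ratio0 : 0 <= (a / t + b) / (e * t).
  by rewrite divr_ge0 ?addr_ge0 ?divr_ge0 ?mulr_ge0 // ltW.
exists (Num.truncn ((a / t + b) / (e * t))).+1 => m hm.
have mM : (a / t + b) <= e * (m%:R * t).
  have h : (a / t + b) / (e * t) <= m%:R.
    by apply/ltW/(lt_le_trans (truncnS_gt _)); rewrite ler_nat.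
  by move: h; rewrite ler_pdivrMr ?mulr_gt0 // mulrCA.
have qr : q ^+ m <= r ^+ m * r ^+ m.
  rewrite -exprMn lerXn2r ?nnegrE ?mulr_ge0 // /r; nra.
have amb : 0 <= a * m%:R + b by rewrite addr_ge0 // mulr_ge0.
apply: le_trans (ler_wpM2l amb qr) _.
have := bernoulli_decay m r01; rewrite -/t.
have : 0 <= r ^+ m by rewrite exprn_ge0.
have at0 : a = (a / t) * t by rewrite divfK // gt_eqF.
have := ler0n R m; have : 0 <= a / t by rewrite divr_ge0 // ltW.
move: mM amb; rewrite at0; move: (a / t) => c; rewrite mulfK ?gt_eqF //.
move: (m%:R) (r ^+ m) => x s mM amb c0 x0 s0 hs.
have st : s * (x * t) <= 1 by nra.
have sxt0 : 0 <= s * (x * t) by rewrite !mulr_ge0 // ltW.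
have s1 : s <= 1 by lra.
have cs : (c * t * x + b) * s <= c + b.
  have : c * (s * (x * t)) <= c * 1 by rewrite ler_wpM2l.
  have : b * s <= b * 1 by rewrite ler_wpM2l.
  by lra.
rewrite mulrA; apply: le_trans (ler_wpM2r s0 cs) _.
apply: le_trans (ler_wpM2r s0 mM) _.
have : e * (s * (x * t)) <= e * 1 by rewrite ler_wpM2l // ltW.
by lra.
Qed.

End GeometricDecay.

Section Convergence.
Context {R : realType} {A : cstarType R}.
Implicit Types x y : nat -> A.

Definition climit x (l : A) :=
  forall e : R, 0 < e -> exists M, forall k, (M <= k)%N -> nrm (x k - l) <= e.

Lemma geometric_tail x (C : R) (k m : nat) :
  (forall k, nrm (x k.+1 - x k) <= C * 2^-1 ^+ k) ->
  nrm (x (m + k)%N - x k) <= 2 * C * (2^-1 ^+ k - 2^-1 ^+ (m + k)).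
Proof.
move=> h; elim: m => [|m IH]; first by rewrite add0n !subrr nrm0 mulr0.
rewrite addSn; apply: le_trans (nrm_sub_trans (x (m + k)%N) _ _) _.
have := h (m + k)%N; rewrite exprS; move: IH; lra.
Qed.

Lemma geometric_climit x (C : R) : 0 <= C ->
  (forall k, nrm (x k.+1 - x k) <= C * 2^-1 ^+ k) ->
  exists2 l, climit x l & nrm (x 0%N - l) <= 2 * C.
Proof.
move=> C0 h.
have tail k m : (k <= m)%N -> nrm (x m - x k) <= 2 * C * 2^-1 ^+ k.
  move=> km; have := geometric_tail k (m - k) h; rewrite subnK //.
  have : 0 <= C * 2^-1 ^+ m by rewrite mulr_ge0 // exprn_ge0.
  lra.
have small (e : R) : 0 < e -> exists M, 2 * C * 2^-1 ^+ M <= e.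
  move=> e0; have [||||M hM] := @linear_geometric_decay _ 2^-1 0 (2 * C) e => //.
  - by apply/andP; split; lra.
  - by rewrite mulr_ge0.
  - by exists M; have := hM M (leqnn M); rewrite mul0r add0r.
have xcvg : cvg (x @ \oo).
  apply/cauchy_cvgP/cauchy_exP => e e0.
  have eR : e = (complex.Re e)%:C by rewrite RRe_real // gtr0_real.
  have e0' : 0 < complex.Re e / 2.
    by move: e0; rewrite eR ltcR /= => ?; rewrite divr_gt0.
  have [M hM] := small _ e0'; exists (x M), M => // m /= Mm.
  rewrite -ball_normE /= nrmE eR ltcR nrmB.
  apply: le_lt_trans (tail _ _ Mm) (le_lt_trans hM _); lra.
have xlim (e : R) : 0 < e -> exists M, forall k, (M <= k)%N -> nrm (x k - lim (x @ \oo)) <= e.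
  move=> e0; have /cvgrPdist_le/(_ e%:C) := xcvg.
  rewrite ltcR => /(_ e0)[M _ hM]; exists M => k Mk.
  by rewrite nrmB -lecR -nrmE; exact: hM.
exists (lim (x @ \oo)) => //.
apply/ler_addgt0Pr => e e0; have [M hM] := xlim e e0.
apply: le_trans (nrm_sub_trans (x M) _ _) _.
have := tail 0%N M isT; rewrite expr0 mulr1 nrmB => ?.
by apply: lerD => //; exact: hM.
Qed.

Lemma climit_unique x (l m : A) : climit x l -> climit x m -> l = m.
Proof.
move=> xl xm; apply/eqP; rewrite -subr_eq0; apply/eqP/nrm_eq0/eqP.
rewrite eq_le nrm_ge0 andbT; apply/ler_addgt0Pr => e e0; rewrite add0r.
have e2 : 0 < e / 2 by lra.
have [M hM] := xl _ e2; have [M' hM'] := xm _ e2.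
apply: le_trans (nrm_sub_trans (x (maxn M M')) _ _) _; rewrite nrmB.
have := hM _ (leq_maxl M M'); have := hM' _ (leq_maxr M M'); lra.
Qed.

Lemma climit_bounded x (l : A) : climit x l ->
  exists M, forall k, (M <= k)%N -> nrm (x k) <= nrm l + 1.
Proof.
move=> /(_ 1 ltr01)[M hM]; exists M => k /hM h.
by apply: le_trans (nrm_le_sub _ l) _; rewrite lerD2l.
Qed.

Lemma climit_cst (a : A) : climit (fun=> a) a.
Proof. by move=> e e0; exists 0%N => k _; rewrite subrr nrm0 ltW. Qed.

Lemma climit_eq x y (l : A) : x =1 y -> climit x l -> climit y l.
Proof. by move=> xy h e /h[M hM]; exists M => k; rewrite -xy; exact: hM. Qed.

Lemma climitS x (l : A) : climit x l -> climit (fun k => x k.+1) l.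
Proof. by move=> h e /h[M hM]; exists M => k Mk; apply: hM; exact: leqW. Qed.

Lemma climitD x y (l m : A) :
  climit x l -> climit y m -> climit (fun k => x k + y k) (l + m).
Proof.
move=> xl ym e e0; have e2 : 0 < e / 2 by lra.
have [M hM] := xl _ e2; have [M' hM'] := ym _ e2.
exists (maxn M M') => k; rewrite geq_max => /andP[/hM h /hM' h'].
rewrite opprD addrACA; apply: le_trans (nrmD _ _) _; lra.
Qed.

Lemma climitZ (c : R[i]) x (l : A) :
  climit x l -> climit (fun k => c *: x k) (c *: l).
Proof.
move=> xl e e0; have c1 : 0 < nrm c + 1 by have := nrm_ge0 c; lra.
have [M hM] := xl (e / (nrm c + 1)) (divr_gt0 e0 c1).
exists M => k /hM; rewrite -scalerBr nrmZ ler_pdivlMr // => h.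
have := nrm_ge0 (x k - l); nra.
Qed.

Lemma climitN x (l : A) : climit x l -> climit (fun k => - x k) (- l).
Proof. by move=> h e /h[M hM]; exists M => k /hM; rewrite -opprD nrmN. Qed.

Lemma climit_star x (l : A) :
  climit x l -> climit (fun k => star (x k)) (star l).
Proof. by move=> h e /h[M hM]; exists M => k /hM; rewrite -starB nrm_star. Qed.

Lemma climitM x y (l m : A) :
  climit x l -> climit y m -> climit (fun k => x k * y k) (l * m).
Proof.
move=> xl ym e e0; pose B := nrm l + 1 + (nrm m + 1).
have B0 : 0 < B by rewrite /B; have := nrm_ge0 l; have := nrm_ge0 m; lra.
have [K hK] := climit_bounded xl.
have [M hM] := xl _ (divr_gt0 e0 B0); have [M' hM'] := ym _ (divr_gt0 e0 B0).
exists (maxn K (maxn M M')) => k.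
rewrite !geq_max => /and3P[/hK bk /hM h /hM' h'].
have -> : x k * y k - l * m = x k * (y k - m) + (x k - l) * m.
  by rewrite mulrBr mulrBl addrA subrK.
apply: le_trans (nrmD _ _) _.
have := nrmM_le bk h'; have := nrmM_le h (lexx (nrm m)).
have eB : e = e / B * B by rewrite divfK // gt_eqF.
move: (e / B) eB {h h'} (divr_gt0 e0 B0) => t -> t0; rewrite /B; nra.
Qed.

End Convergence.

(** * Boundedness of *-homomorphisms *)

Section StarHoms.
Context {R : realType}.

Lemma nrm_half : nrm (2^-1 : R[i]) = 2^-1.
Proof.
have -> : (2^-1 : R[i]) = (2^-1 : R)%:C by rewrite fmorphV rmorph_nat.
by rewrite nrm_real ger0_norm // invr_ge0.
Qed.

Lemma nrm_halfZ (A : cstarType R) (x : A) :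
  nrm ((2^-1 : R[i]) *: x) = 2^-1 * nrm x.
Proof. by rewrite nrmZ nrm_half. Qed.

Lemma halfD (A : cstarType R) (x : A) : (2^-1 : R[i]) *: (x + x) = x.
Proof.
have h : (2^-1 : R[i]) + 2^-1 = 1 by field.
by rewrite scalerDr -scalerDl h scale1r.
Qed.

Lemma half_conj : ((2^-1 : R[i])^*)%R = 2^-1.
Proof. by rewrite fmorphV rmorph_nat. Qed.

Section SquareRoot.
Context {A : cstarType R}.
Implicit Types x y w : A.

(** The fixed point l of y |-> (x^2 + y^2) / 2, a contraction of the ball of
    radius 1/2, satisfies (1 - l)^2 = 1 - x^2; it is a limit of polynomials in
    x. This replaces continuous functional calculus. *)
Lemma sqrt_one_sub_sqr x : star x = x -> nrm x <= 2^-1 ->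
  exists w, [/\ star w = w, x * w = w * x & x * x + w * w = 1].
Proof.
move=> xs xh; pose step y := (2^-1 : R[i]) *: (x * x + y * y).
pose y k := iter k step 0.
have yb k : nrm (y k) <= 2^-1.
  elim: k => [|k IH]; first by rewrite /= nrm0; lra.
  rewrite /= nrm_halfZ; have := nrmD (x * x) (y k * y k).
  have := nrmM_le xh xh; have := nrmM_le IH IH; lra.
have yd k : nrm (y k.+1 - y k) <= 1 * 2^-1 ^+ k.
  elim: k => [|k IH].
    by have := yb 1%N; rewrite /= subr0 expr0; lra.
  rewrite exprS mulrCA.
  have -> : y k.+2 - y k.+1 =
      (2^-1 : R[i]) *: (y k.+1 * (y k.+1 - y k) + (y k.+1 - y k) * y k).
    rewrite [in LHS]/y !iterS -/(y k) -/(y k.+1) /step -scalerBr.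
    by rewrite opprD addrACA subrr add0r mulrBr mulrBl addrA subrK.
  rewrite nrm_halfZ ler_wpM2l ?invr_ge0 //.
  apply: le_trans (nrmD _ _) _.
  have := nrmM_le (yb k.+1) IH; have := nrmM_le IH (yb k); lra.
have [l yl _] := geometric_climit ler01 yd.
have lE : l = (2^-1 : R[i]) *: (x * x + l * l).
  apply: (climit_unique (climitS yl)); apply: climitZ.
  by apply: climitD; [exact: climit_cst|exact: climitM].
have ys k : star (y k) = y k.
  elim: k => [|k IH]; first exact: star0.
  by rewrite /= starZ half_conj starD !csM IH xs.
have xy k : x * y k = y k * x.
  elim: k => [|k IH]; first by rewrite /= mulr0 mul0r.
  by rewrite /= csZr csZl mulrDr mulrDl mulrA [x * (_ * _)]mulrA IH -!mulrA IH.
have ls : star l = l.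
  by apply: (climit_unique (climit_star yl)); apply: climit_eq yl => k; rewrite ys.
have xl : x * l = l * x.
  apply: (climit_unique (climitM (climit_cst x) yl)).
  by apply: climit_eq (climitM yl (climit_cst x)) => k; rewrite xy.
exists (1 - l); split.
- by rewrite starB star1 ls.
- by rewrite mulrBr mulrBl mulr1 mul1r xl.
- have l2 : l + l = x * x + l * l by rewrite {1 2}lE -scalerDr halfD.
  have -> : x * x = l + l - l * l by rewrite l2 addrK.
  rewrite mulrBr mulr1 mulrBl mul1r opprB addrC -!addrA addKr.
  by rewrite [_ + (l - _)]addrCA subrr addr0 addNr addr0.
Qed.

End SquareRoot.

Section Bounded.
Context {A B : cstarType R} (f : A -> B) (fhom : star_hom f).
Implicit Types x y : A.

Lemma star_homD x y : f (x + y) = f x + f y.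
Proof. by have [fl _ _ _] := fhom; rewrite -[x]scale1r fl !scale1r. Qed.

Lemma star_hom0 : f 0 = 0.
Proof. by apply: (@addrI _ (f 0)); rewrite -star_homD !addr0. Qed.

Lemma star_homZ (c : R[i]) x : f (c *: x) = c *: f x.
Proof. by have [fl _ _ _] := fhom; rewrite -[c *: x]addr0 fl star_hom0 addr0. Qed.

Lemma star_homN x : f (- x) = - f x.
Proof. by rewrite -scaleN1r star_homZ scaleN1r. Qed.

Lemma star_homB x y : f (x - y) = f x - f y.
Proof. by rewrite star_homD star_homN. Qed.

Lemma star_hom1 : f 1 = 1. Proof. by have [] := fhom. Qed.

Lemma star_homM x y : f (x * y) = f x * f y.
Proof. by have [] := fhom. Qed.

Lemma star_homJ x : f (star x) = star (f x).
Proof. by have [] := fhom. Qed.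

Lemma star_homX x k : f (x ^+ k) = f x ^+ k.
Proof.
elim: k => [|k IH]; first by rewrite !expr0 star_hom1.
by rewrite !exprS star_homM IH.
Qed.

Lemma star_hom_sum (I : Type) (r : seq I) (P : pred I) (F : I -> A) :
  f (\sum_(i <- r | P i) F i) = \sum_(i <- r | P i) f (F i).
Proof. by apply: (big_morph f); [exact: star_homD|exact: star_hom0]. Qed.

(** Any *-homomorphism sends unitaries to unitaries, which have norm at most
    1, and x is the average of the unitary x + i w and its adjoint, where w is
    a square root of 1 - x^2. *)
Lemma star_hom_small x : star x = x -> nrm x <= 2^-1 -> nrm (f x) <= 1.
Proof.
move=> xs /(sqrt_one_sub_sqr xs)[w [ws xw sq]].
pose v := x + ('i%R : R[i]) *: w.
have vs : star v = x - ('i%R : R[i]) *: w.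
  by rewrite starD starZ conjCi xs ws scaleNr.
have ii : ('i%R : R[i]) * 'i%R = -1 by rewrite -expr2 sqrCi.
have vU : unitary v.
  split; rewrite vs /v
      !(mulrDl, mulrDr, mulNr, mulrN, csZl, csZr, scalerDr, scalerN, scalerA);
    by rewrite ii scaleN1r opprK xw addrA (addrK, subrK).
have fvU : unitary (f v).
  by case: vU => h h'; split; rewrite -star_homJ -star_homM ?h ?h' star_hom1.
have -> : x = (2^-1 : R[i]) *: (v + star v).
  by rewrite vs addrACA subrr addr0 halfD.
rewrite star_homZ star_homD star_homJ nrm_halfZ.
apply: le_trans (ler_wpM2l _ (nrmD _ _)) _; first by rewrite invr_ge0.
rewrite nrm_star; have := nrm_unitary fvU; lra.
Qed.

Lemma star_hom_sa x : star x = x -> nrm (f x) <= 2 * nrm x.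
Proof.
move=> xs; have [x0|x0] := eqVneq (nrm x) 0.
  by rewrite x0 mulr0 (nrm_eq0 x0) star_hom0 nrm0.
have xp : 0 < nrm x by rewrite lt_neqAle eq_sym x0 nrm_ge0.
pose c : R := (2 * nrm x)^-1.
have c0 : 0 < c by rewrite invr_gt0; lra.
have cx : nrm (c%:C *: x) <= 2^-1.
  by rewrite nrmZ nrm_real gtr0_norm // /c invfM mulfVK.
have cs : star (c%:C *: x) = c%:C *: x.
  by rewrite starZ xs; congr (_ *: _); apply/CrealP; rewrite complex_real.
have := star_hom_small cs cx; rewrite star_homZ nrmZ nrm_real gtr0_norm //.
by rewrite /c mulrC ler_pdivrMr ?mul1r //; lra.
Qed.

(** The constant 4 comes from splitting x into two self-adjoint parts and from
    the ball of radius 1/2 in the previous lemmas; any constant would do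
    below. *)
Lemma star_hom_bounded x : nrm (f x) <= 4 * nrm x.
Proof.
pose a := (2^-1 : R[i]) *: (x + star x).
pose b := (2^-1 * 'i%R : R[i]) *: (star x - x).
have as_ : star a = a by rewrite starZ half_conj starD starK addrC.
have bs : star b = b.
  by rewrite starZ rmorphM /= half_conj conjCi starB starK mulrN scaleNr -scalerN opprB.
have xE : x = a + ('i%R : R[i]) *: b.
  rewrite scalerA mulrCA -expr2 sqrCi mulrN1 scaleNr -scalerN opprB.
  by rewrite -scalerDr addrACA subrr addr0 halfD.
have an : nrm a <= nrm x.
  rewrite nrm_halfZ; have := nrmD x (star x); rewrite nrm_star; lra.
have ni : nrm ('i%R : R[i]) = 1 by rewrite /nrm normCi.
have bn : nrm b <= nrm x.
  rewrite nrmZ nrmCM ni mulr1 nrm_half.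
  have := nrmD (star x) (- x); rewrite nrmN nrm_star; lra.
rewrite [in f x]xE star_homD star_homZ; apply: le_trans (nrmD _ _) _.
rewrite nrmZ ni; have := star_hom_sa as_; have := star_hom_sa bs; lra.
Qed.

End Bounded.

End StarHoms.

(** * From almost projections to projections *)

Section Projections.
Context {R : realType} {A : cstarType R}.
Implicit Types x y z q : A.

Lemma climit_geometric0 (x : nat -> A) (C : R) : 0 <= C ->
  (forall k, nrm (x k) <= C * 2^-1 ^+ k) -> climit x 0.
Proof.
move=> C0 h e e0; have half01 : 0 <= (2^-1 : R) < 1 by apply/andP; split; lra.
have [M hM] := linear_geometric_decay half01 (lexx 0) C0 e0.
exists M => k /hM; rewrite mul0r add0r subr0; exact: le_trans.
Qed.

Definition idem_defect z := z * z - z.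

(** The cubic z |-> 3 z^2 - 2 z^3, for which 0 and 1 are superattracting fixed
    points; in this form it visibly moves z by a multiple of its defect. *)
Definition idem_step z := z + (1 - (z + z)) * idem_defect z.

Lemma comm_defect z : z * idem_defect z = idem_defect z * z.
Proof. by rewrite mulrBr mulrBl mulrA. Qed.

Lemma mul_comm_affine z y : z * y = y * z ->
  y * (1 - (z + z)) = (1 - (z + z)) * y.
Proof. by move=> h; rewrite mulrBr mulrDr mulrBl mulrDl mulr1 mul1r h. Qed.

Lemma affine_sqr z e : z * z = z + e ->
  (1 - (z + z)) * (1 - (z + z)) = 1 + (e + e + (e + e)).
Proof.
move=> zz; rewrite mulrBl mul1r mulrBr mulr1 mulrDl mulrDr zz.
rewrite [z + e + _]addrACA; move: (z + z) (e + e) => a b.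
rewrite opprB -[a + b + _]addrA [a + (b + _)]addrC addrK.
by rewrite [b + (a + b)]addrCA subrKA.
Qed.

(** With e = z^2 - z, the new defect is 4 e^3 - 3 e^2: iteration converges
    quadratically. *)
Lemma idem_stepP z : let e := idem_defect z in
  idem_defect (idem_step z) =
    (e * e * e + e * e * e + (e * e * e + e * e * e)) + e * e -
    (e * e + e * e + (e * e + e * e)).
Proof.
move: (comm_defect z) (erefl (idem_step z)).
have : z * z = z + idem_defect z by rewrite addrC subrK.
rewrite {2}/idem_step; move: (idem_defect z) => e /= zz ze ->.
have cc := affine_sqr zz; have ec := mul_comm_affine ze.
have zc := mul_comm_affine (erefl (z * z)).
have [c cE] : exists c, c = 1 - (z + z) by exists (1 - (z + z)).
rewrite -cE in cc ec zc *.
pose t := c * e; rewrite /idem_defect -/t.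
have zt : t * z = z * t by rewrite mulrA zc -!mulrA ze.
have ct : c * t = e + (e * e + e * e + (e * e + e * e)).
  by rewrite mulrA cc !mulrDl mul1r.
have tt : t * t = e * e + (e * e * e + e * e * e + (e * e * e + e * e * e)).
  have -> : t * t = c * c * (e * e) by rewrite /t -[c * e * _]mulrA [e * (c * e)]mulrA ec !mulrA.
  rewrite cc !mulrDl mul1r.
  by rewrite !mulrA.
have ctE : c * t = t - (z * t + z * t) by rewrite cE mulrBl mul1r mulrDl.
have -> : (z + t) * (z + t) - (z + t) = t * t + (e - c * t).
  rewrite mulrDl !mulrDr zz zt ctE opprB opprD.
  by rewrite (AC ((3*2)*2) ((1*6)*(5*(2*((3*4)*7)))))/= subrr add0r.
by rewrite ct tt opprD [e + (_ - _)]addrA subrr sub0r [e * e + _ in LHS]addrC.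
Qed.

Lemma nrm_sa_sqr z : star z = z -> nrm (z * z) = nrm z ^+ 2.
Proof. by move=> zs; rewrite -nrm_cstar zs. Qed.

Lemma nrm_almost_idem z (d : R) : star z = z -> 0 <= d <= 1 ->
  nrm (idem_defect z) <= d -> nrm z <= 2.
Proof.
move=> zs /andP[d0 d1] zd.
have := nrm_le_sub (z * z) z; rewrite nrm_sa_sqr // -/(idem_defect z).
have := nrm_ge0 z; nra.
Qed.

Lemma nrm_idem_step z (d : R) : star z = z -> 0 <= d <= 32^-1 -> nrm (idem_defect z) <= d ->
  nrm (idem_defect (idem_step z)) <= d / 2 /\ nrm (idem_step z - z) <= 5 * d.
Proof.
move=> zs /andP[d0 d1] ed; split.
  have := idem_stepP z; move: (idem_defect z) ed => e ed /= ->.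
  have e2 := nrmM_le ed ed; have e3 := nrmM_le e2 ed.
  have dd x y (a b : R) : nrm x <= a -> nrm y <= b -> nrm (x + y) <= a + b.
    by move=> xa yb; apply: le_trans (nrmD _ _) (lerD xa yb).
  have := dd _ _ _ _ (dd _ _ _ _ (dd _ _ _ _ (dd _ _ _ _ e3 e3) (dd _ _ _ _ e3 e3)) e2).
  have e4 := dd _ _ _ _ (dd _ _ _ _ e2 e2) (dd _ _ _ _ e2 e2).
  rewrite -nrmN in e4; move=> /(_ _ _ e4) h; apply: le_trans h _.
  have : d * d <= 32^-1 * d by rewrite ler_wpM2r.
  have : d * d * d <= 32^-1 * d * d by rewrite !ler_wpM2r.
  lra.
have zb : nrm z <= 2.
  by apply: nrm_almost_idem zs _ ed; rewrite d0 /=; apply: le_trans d1 _; lra.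
rewrite /idem_step addrAC subrr add0r.
apply: (@nrmM_le _ _ _ _ 5 d) => //.
apply: le_trans (nrmD _ _) _; rewrite nrmN; have := nrmD z z.
by have := @nrm1_le1 _ A; lra.
Qed.

(** The projection is the limit of the iterates of the cubic. These have no
    constant term, so whatever x annihilates stays annihilated; the construction
    of orthogonal projections relies on that. *)
Lemma projection_near x (d : R) : 0 <= d <= 32^-1 -> star x = x ->
  nrm (x * x - x) <= d ->
  exists q, [/\ projection q, nrm (x - q) <= 10 * d &
    forall r, x * r = 0 -> q * r = 0].
Proof.
move=> d01 xs xd; have /andP[d0 d1] := d01.
pose y k := iter k idem_step x.
have ys k : star (y k) = y k.
  elim: k => [|k IH] //=; rewrite {1}/idem_step starD csM !starB star1 starD.
  by rewrite !csM IH -/(idem_defect (y k)) (mul_comm_affine (comm_defect _)).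
have dk k : 0 <= d * 2^-1 ^+ k <= 32^-1.
  rewrite mulr_ge0 ?exprn_ge0 //=; apply: le_trans d1.
  by rewrite ler_piMr // exprn_ile1 //; lra.
have yd k : nrm (idem_defect (y k)) <= d * 2^-1 ^+ k.
  elim: k => [|k IH]; first by rewrite expr0 mulr1.
  by have [h _] := nrm_idem_step (ys k) (dk k) IH; rewrite exprSr mulrA.
have y1 k : nrm (y k.+1 - y k) <= 5 * d * 2^-1 ^+ k.
  by have [_ h] := nrm_idem_step (ys k) (dk k) (yd k); rewrite -mulrA.
have d5 : 0 <= 5 * d by lra.
have [q yq xq] := geometric_climit d5 y1.
exists q; split.
- split.
    apply/eqP; rewrite -subr_eq0; apply/eqP.
    apply: (climit_unique _ (climit_geometric0 d0 yd)).
    by apply: climitD; [exact: climitM|exact: climitN].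
  by apply: (climit_unique (climit_star yq)); apply: climit_eq yq => k; rewrite ys.
- by apply: le_trans xq _; lra.
- move=> r xr; apply: (climit_unique (climitM yq (climit_cst r))).
  apply: (climit_eq _ (climit_cst 0)) => k; elim: k => [|k IH] //=.
  have er : idem_defect (y k) * r = 0 by rewrite mulrBl -mulrA -IH mulr0 subrr.
  by rewrite /idem_step mulrDl -mulrA er -IH mulr0 addr0.
Qed.

Lemma projectionC q : projection q -> projection (1 - q).
Proof.
case=> qq qs; split; last by rewrite starB star1 qs.
by rewrite mulrBl mul1r mulrBr mulr1 qq subrr subr0.
Qed.

Definition orth_projections m (e : nat -> A) :=
  (forall k, (k < m)%N -> projection (e k)) /\
  (forall k l, (k < m)%N -> (l < m)%N -> k != l -> e k * e l = 0).

Lemma orth_projections_mul_sum m e k : orth_projections m e -> (k < m)%N ->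
  (\sum_(i < m) e i) * e k = e k.
Proof.
move=> [ep eo] km; rewrite mulr_suml (bigD1 (Ordinal km)) //=.
rewrite big1 ?addr0 => [|i ik]; first by have [] := ep k km.
exact: eo.
Qed.

Lemma orth_projections_sum m e :
  orth_projections m e -> projection (\sum_(i < m) e i).
Proof.
move=> h; split.
  by rewrite mulr_sumr; apply: eq_bigr => i _; rewrite orth_projections_mul_sum.
rewrite star_sum; apply: eq_bigr => i _.
by have [ep _] := h; have [] := ep i (ltn_ord i).
Qed.

Definition almost_orth_projections n (d : R) (h : nat -> A) :=
  (forall k, (k < n)%N -> star (h k) = h k) /\
  (forall k l, (k < n)%N -> (l < n)%N ->
    nrm (h k * h l - (k == l)%:R *: h k) <= d).

(** Once m orthogonal projections with sum E are found, the next element s is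
    compressed to (1 - E) s (1 - E) before it is made a projection: the
    compression changes s little since E s is small, and it kills E. *)
Lemma orth_projections_near n m (eps : R) : (m <= n)%N -> 0 < eps ->
  exists2 d : R, 0 < d & forall h, almost_orth_projections n d h ->
  exists2 e, orth_projections m e & forall k, (k < m)%N -> nrm (e k - h k) <= eps.
Proof.
elim: m eps => [|m IH] eps mn eps0.
  by exists 1 => // h _; exists (fun=> 0) => //; split.
(* The compression costs 9 m eps1 and the defect is at most (54 m + 1) eps1;
   K makes the defect at most 1/32 and the total displacement at most eps. *)
pose K : R := 1728 * m%:R + 550.
have m0 : 0 <= m%:R :> R by [].
have K0 : 0 < K by rewrite /K; lra.
pose eps1 : R := Num.min 1 eps / K.
have eps10 : 0 < eps1 by rewrite divr_gt0 // lt_min ltr01.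
have Keps1 : K * eps1 <= 1 /\ K * eps1 <= eps.
  by rewrite mulrC divfK ?gt_eqF // !ge_min !lexx orbT.
have [d1 d10 {}IH] := IH eps1 (ltnW mn) eps10.
exists (Num.min d1 eps1) => [|h [hs ho]]; first by rewrite lt_min d10.
have [|e eP eh] := IH h.
  by split=> // k l kn ln; apply: le_trans (ho _ _ kn ln) _; rewrite ge_min lexx.
have {}ho k l : (k < n)%N -> (l < n)%N ->
    nrm (h k * h l - (k == l)%:R *: h k) <= eps1.
  by move=> kn ln; apply: le_trans (ho _ _ kn ln) _; rewrite ge_min lexx orbT.
pose E := \sum_(i < m) e i; pose s := h m; have ss : star s = s by exact: hs.
have EP : projection E by exact: orth_projections_sum.
have [EE Es] := EP; have En := nrm_proj_le1 EP.
have sd : nrm (s * s - s) <= eps1.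
  by have := ho m m mn mn; rewrite eqxx scale1r.
have eps11 : 0 <= eps1 <= 1.
  by rewrite ltW //=; case: Keps1 => + _; rewrite /K; nra.
have sn : nrm s <= 2 by apply: nrm_almost_idem ss eps11 sd.
have Esn : nrm (E * s) <= m%:R * (3 * eps1).
  rewrite mulr_suml; apply: le_trans (nrm_sum _ _ _) _.
  have -> : m%:R * (3 * eps1) = \sum_(i < m) 3 * eps1.
    by rewrite sumr_const card_ord -[RHS]mulr_natl.
  apply: ler_sum => i _; have im := ltn_ord i.
  have -> : e i * s = (e i - h i) * s + h i * s by rewrite mulrBl subrK.
  apply: le_trans (nrmD _ _) _.
  have := nrmM_le (eh _ im) sn; have := ho i m (ltn_trans im mn) mn.
  by rewrite (ltn_eqF im) scale0r subr0; lra.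
have sEn : nrm (s * E) <= m%:R * (3 * eps1).
  by rewrite -nrm_star csM Es ss.
pose x := (1 - E) * s * (1 - E).
have EC := projectionC EP; have [_ ECs] := EC.
have xs : star x = x by rewrite 2!csM ECs ss mulrA.
have xE : x * E = 0.
  by rewrite /x -(mulrA _ (1 - E)) [(1 - E) * E]mulrBl mul1r EE subrr mulr0.
have xsE : x - s = E * s * E - E * s - s * E.
  rewrite /x mulrBl mul1r mulrBr mulr1 mulrBl opprB.
  by rewrite (AC ((2*2)*1) ((1*5)*((3*2)*4)))/= subrr add0r.
have xsn : nrm (x - s) <= 9 * m%:R * eps1.
  rewrite xsE; have := nrmD (E * s * E - E * s) (- (s * E)).
  have := nrmD (E * s * E) (- (E * s)); have := nrmM_le Esn En.
  by rewrite !nrmN; lra.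
have xn : nrm x <= 2.
  by have := nrmM_le (nrmM_le (nrm_proj_le1 EC) sn) (nrm_proj_le1 EC); lra.
pose D := 54 * m%:R * eps1 + eps1.
have me : 0 <= m%:R * eps1 by rewrite mulr_ge0 //; case/andP: eps11.
have xx : nrm (x * x - x) <= D.
  have -> : x * x - x = x * (x - s) + (x - s) * s + (s * s - s) - (x - s).
    rewrite mulrBr mulrBl opprB.
    rewrite (AC ((2*2*2)*2) ((1*8)*((2*3)*((4*5)*(6*7)))))/=.
    by rewrite !addNr !addr0.
  apply: le_trans (nrmD _ _) _; rewrite nrmN /D.
  have := nrmD (x * (x - s) + (x - s) * s) (s * s - s).
  have := nrmD (x * (x - s)) ((x - s) * s).
  have := nrmM_le xn xsn; have := nrmM_le xsn sn; lra.
have [h1 h2] := Keps1.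
have K1 : K * eps1 = 1728 * (m%:R * eps1) + 550 * eps1 by rewrite /K; lra.
have [|q [qP xq qr]] := projection_near _ xs xx.
  move/andP: eps11 => [eps1_ge0 _].
  by rewrite /D; apply/andP; split; move: me eps1_ge0 h1 K1; clear; lra.
have [qq qs] := qP; have [ep eo] := eP.
have qe k : (k < m)%N -> q * e k = 0.
  move=> km; rewrite -(orth_projections_mul_sum eP km) mulrA (qr _ xE).
  by rewrite mul0r.
have eq_ k : (k < m)%N -> e k * q = 0.
  by move=> km; have [_ <-] := ep k km; rewrite -qs -csM qe // star0.
have [e' [e'k e'm]] :
    exists e', (forall k, (k < m)%N -> e' k = e k) /\ e' m = q.
  exists (fun k => if (k < m)%N then e k else q).
  by split=> [k km|]; rewrite ?km // ltnn.
exists e'; first split.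
- move=> k; rewrite ltnS leq_eqVlt => /orP[/eqP ->|km]; first by rewrite e'm.
  by rewrite e'k //; exact: ep.
- move=> k l; rewrite 2!ltnS [(k <= m)%N]leq_eqVlt [(l <= m)%N]leq_eqVlt.
  move=> /orP[/eqP->|km] /orP[/eqP->|lm] kl.
  + by rewrite eqxx in kl.
  + by rewrite e'm (e'k l lm) (qe l lm).
  + by rewrite e'm (e'k k km) (eq_ k km).
  + by rewrite (e'k k km) (e'k l lm) (eo k l km lm kl).
- move=> k; rewrite ltnS leq_eqVlt => /orP[/eqP ->|km].
    rewrite e'm; apply: le_trans (nrm_sub_trans x _ _) _.
    by rewrite nrmB; move: xq xsn K1 h2 me (ltW eps10); rewrite /D -/s; clear; lra.
  by rewrite e'k //; apply: le_trans (eh k km) _; move: h2 K1 me (ltW eps10); clear; lra.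
Qed.

(** If the given elements almost sum to 1, then so do the orthogonal
    projections close to them; the complement of their sum is a projection of
    norm less than 1, hence zero. *)
Lemma partition_near n (eps : R) : 0 < eps ->
  exists2 d : R, 0 < d & forall h, almost_orth_projections n d h ->
  nrm (\sum_(i < n) h i - 1) <= d ->
  exists e, [/\ orth_projections n e, \sum_(i < n) e i = 1 &
    forall k, (k < n)%N -> nrm (e k - h k) <= eps].
Proof.
move=> eps0; have n0 : 0 <= n%:R :> R by [].
have n1 : 0 < 2 * (n%:R + 1) :> R by lra.
pose eps1 := Num.min eps (2 * (n%:R + 1))^-1.
have eps10 : 0 < eps1 by rewrite lt_min eps0 invr_gt0.
have [d d0 hd] := orth_projections_near (leqnn n) eps10.
exists (Num.min d 4^-1) => [|h [hs ho] h1]; first by rewrite lt_min d0; lra.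
have [|e eP eh] := hd h.
  by split=> // k l kn ln; apply: le_trans (ho _ _ kn ln) _; rewrite ge_min lexx.
exists e; split=> // [|k kn].
  apply/esym/eqP; rewrite -subr_eq0; apply/eqP.
  apply: (nrm_proj_lt1 (projectionC (orth_projections_sum eP))).
  apply: le_lt_trans (nrm_sub_trans (\sum_(i < n) h i) _ _) _.
  have : nrm (\sum_(i < n) h i - \sum_(i < n) e i) <= n%:R * eps1.
    rewrite -sumrB; apply: le_trans (nrm_sum _ _ _) _.
    have -> : n%:R * eps1 = \sum_(i < n) eps1.
      by rewrite sumr_const card_ord -[RHS]mulr_natl.
    by apply: ler_sum => i _; rewrite nrmB eh.
  have : n%:R * eps1 <= n%:R * (2 * (n%:R + 1))^-1.
    by rewrite ler_wpM2l // ge_min lexx orbT.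
  have : n%:R * (2 * (n%:R + 1))^-1 <= 2^-1 :> R.
    by rewrite ler_pdivrMr //; lra.
  move: h1; rewrite nrmB => h1; have : Num.min d 4^-1 <= 4^-1 by rewrite ge_min lexx orbT.
  lra.
by apply: le_trans (eh k kn) _; rewrite ge_min lexx.
Qed.

End Projections.

(** * Roots of unity and the de la Vallee-Poussin kernel *)

Section RootsOfUnity.
Context {R : realType}.

Lemma cisX (t : R) k : cis t ^+ k = cis (k%:R * t).
Proof.
elim: k => [|k IH]; first by rewrite expr0 mul0r /cis cos0 sin0.
by rewrite exprS IH -cisD -natr1 mulrDl mul1r addrC.
Qed.

Lemma cis_neq1 (t : R) : 0 < t < 2 * pi -> cis t != 1.
Proof.
move=> /andP[t0 t1]; apply/eqP => /(congr1 (@complex.Re R)) /= ct.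
have : sin (t / 2) > 0 by apply: sin_gt0_pi; apply/andP; split; lra.
have := cosD (t / 2) (t / 2); have := cos2Dsin2 (t / 2).
have -> : t / 2 + t / 2 = t by lra.
rewrite ct; move: (sin _) (cos _) => s c; rewrite !expr2; nra.
Qed.

Definition rt (N : nat) (l : 'I_N.+1) : circle R := @nth_root R N.+1 l.

Definition rt1 (N : nat) : R[i] := cis (2 * pi / N.+1%:R).

Lemma rtE N (l : 'I_N.+1) : cval (rt l) = rt1 N ^+ l.
Proof. by rewrite CircleK cisX; congr cis; ring. Qed.

Lemma rt1_prim N : N.+1.-primitive_root (rt1 N).
Proof.
have N0 : 0 < N.+1%:R :> R by rewrite ltr0n.
apply/andP; split=> //; apply/forallP => i; apply/eqP; rewrite unity_rootE cisX.
have iN := ltn_ord i; have [->|ne] := eqVneq i.+1 N.+1.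
  have -> : N.+1%:R * (2 * pi / N.+1%:R) = 2 * pi * 1%:R :> R.
    by rewrite mulrC divfK ?gt_eqF // mulr1.
  by rewrite cis_2pin !eqxx.
apply/negbTE/cis_neq1; rewrite mulrCA; apply/andP; split.
  by rewrite !mulr_gt0 ?pi_gt0 ?invr_gt0 ?ltr0n.
rewrite gtr_pMr ?mulr_gt0 ?pi_gt0 // ltr_pdivrMr // mul1r ltr_nat.
by rewrite ltn_neqAle ne.
Qed.

Lemma rt_sum N i j : (i <= N)%N -> (j <= N)%N ->
  \sum_(l < N.+1) cval (rt l) ^+ i * (cval (rt l))^-1 ^+ j =
  N.+1%:R * (i == j)%:R.
Proof.
move=> iN jN; have w := rt1_prim N; set x := rt1 N in w.
have x0 : x != 0 by rewrite -normr_eq0 norm_cis oner_eq0.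
under eq_bigr => l _.
  rewrite rtE -!exprVn -!exprM ![(l * _)%N]mulnC !exprM -exprMn.
  over.
have [->|ne] := eqVneq i j.
  under eq_bigr => l _ do rewrite -exprMn mulfV // expr1n expr1n.
  by rewrite sumr_const card_ord mulr1.
rewrite mulr0; set y := _ * _.
have y1 : y != 1.
  apply: contraNneq ne => h.
  have : x ^+ i = x ^+ j by rewrite -[RHS]mul1r -h mulrAC -mulrA -exprMn mulfV // expr1n mulr1.
  by move/eqP; rewrite (eq_prim_root_expr w) !modn_small ?ltnS.
have yN : y ^+ N.+1 = 1.
  rewrite /y exprMn -!exprM ![(_ * N.+1)%N]mulnC !exprM exprVn (prim_expr_order w).
  by rewrite invr1 !expr1n mulr1.
apply/eqP; have := subrX1 y N.+1; rewrite yN subrr => /esym/eqP.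
by rewrite mulf_eq0 subr_eq0 (negbTE y1).
Qed.

Lemma nrm_sum_real (V : normedModType R[i]) I (r : seq I) (c : I -> R) (v : I -> V) :
  (forall i, 0 <= c i) ->
  nrm (\sum_(i <- r) (c i)%:C *: v i) <= \sum_(i <- r) c i * nrm (v i).
Proof.
move=> c0; apply: le_trans (nrm_sum _ _ _) _; apply: ler_sum => i _.
by rewrite nrmZ nrm_real ger0_norm.
Qed.

End RootsOfUnity.

Section Kernel.
Context {R : realType}.
Implicit Types (z g : circle R) (d : nat).

(** Bounds the normalising constant 4^d / 'C(2 d, d) of the kernel by the
    number 2d+1 of nodes. *)
Lemma central_binomial_lb d : (4 ^ d <= (2 * d).+1 * 'C(2 * d, d))%N.
Proof.
elim: d => [|d IH]; first by rewrite bin0.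
have -> : (2 * d.+1 = (2 * d).+2)%N by lia.
have sym : 'C((2 * d).+1, d) = 'C((2 * d).+1, d.+1).
  by rewrite -bin_sub; [congr binomial|]; lia.
have := mul_bin_diag (2 * d).+1 d; rewrite [in X in _ -> X]binS sym expnS /=.
by move: IH; move: (binomial (2 * d) d) (binomial (2 * d).+1 d.+1) (4 ^ d)%N; nia.
Qed.

Definition circle_dist g : R := nrm (1 - cval g).

(** This is |1 + g|^2 = 4 - |1 - g|^2: the kernel is a power of a real
    number that decreases with the distance of g from 1. *)
Lemma circle_dist_sqr g :
  (1 + cval g) ^+ 2 * (cval g)^-1 = (4 - circle_dist g ^+ 2)%:C.
Proof.
have g0 := cval_neq0 g.
rewrite /circle_dist rmorphB rmorphXn /= -nrmE normCK rmorphB /= rmorph1.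
rewrite conj_cval rmorph_nat; field.
exact: g0.
Qed.

Lemma circle_dist_le2 g : circle_dist g <= 2.
Proof. by have := nrmD 1 (- cval g); rewrite nrmN nrm_circle nrm1C; lra. Qed.

(** Up to a constant this is ((1 + g)(1 + 1/g))^d, the de la Vallee-Poussin
    kernel. Its degree in g is d, so that 2d+1 roots of unity integrate it
    exactly. *)
Definition vp_kernel d g : R :=
  ((2 * d).+1%:R * 'C(2 * d, d)%:R)^-1 * (4 - circle_dist g ^+ 2) ^+ d.

Lemma vp_kernelE d g : (vp_kernel d g)%:C =
  \sum_(t < (2 * d).+1)
     ((2 * d).+1%:R * 'C(2 * d, d)%:R)^-1 * 'C(2 * d, t)%:R *
     (cval g ^+ t * (cval g)^-1 ^+ d).
Proof.
rewrite rmorphM rmorphXn /= -circle_dist_sqr fmorphV rmorphM /= !rmorph_nat.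
rewrite exprMn -exprM [1 + cval g]addrC exprD1n mulr_suml mulr_sumr; apply: eq_bigr => t _.
by rewrite -[_ ^+ t *+ _]mulr_natl !mulrA.
Qed.

(** Only the constant term in z survives the sum over the roots of unity. *)
Lemma vp_kernel_sum d z :
  \sum_(l < (2 * d).+1) vp_kernel d (z * (rt l)^-1)%g = 1.
Proof.
apply: complexI; rewrite rmorph_sum /= rmorph1.
under eq_bigr => l _ do rewrite vp_kernelE.
rewrite exchange_big /=.
have term (t : 'I_(2 * d).+1) (l : 'I_(2 * d).+1) :
    ((2 * d).+1%:R * 'C(2 * d, d)%:R)^-1 * 'C(2 * d, t)%:R *
     (cval (z * (rt l)^-1)%g ^+ t * (cval (z * (rt l)^-1)%g)^-1 ^+ d) =
    ((2 * d).+1%:R * 'C(2 * d, d)%:R)^-1 * 'C(2 * d, t)%:R *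
     (cval z ^+ t * (cval z)^-1 ^+ d) *
     (cval (rt l) ^+ d * (cval (rt l))^-1 ^+ t) :> R[i].
  rewrite [cval (_ * _)%g]/(cval z / cval (rt l)); move: (_ * _)^-1 => K.
  rewrite invfM invrK !exprMn.
  by ring.
under eq_bigr => t _.
  under eq_bigr => l _ do rewrite term.
  rewrite -mulr_sumr rt_sum; [over|lia|by rewrite -ltnS].
have dlt : (d < (2 * d).+1)%N by lia.
rewrite (bigD1 (Ordinal dlt)) //= big1 ?addr0 => [|t td].
  rewrite eqxx mulr1 mulrAC -exprMn mulfV ?cval_neq0 // expr1n mulr1.
  rewrite -mulrA [X in _ * X]mulrC mulVf // mulf_neq0 // pnatr_eq0 //.
  by rewrite -lt0n bin_gt0; lia.
rewrite -val_eqE /= eq_sym in td.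
by rewrite (negbTE td) !mulr0.
Qed.

Lemma vp_kernel_ge0 d g : 0 <= vp_kernel d g.
Proof.
rewrite mulr_ge0 ?invr_ge0 ?mulr_ge0 // exprn_ge0 //.
have := circle_dist_le2 g; have : 0 <= circle_dist g by exact: nrm_ge0.
by rewrite expr2; nra.
Qed.

Lemma vp_kernel_far d g (eta : R) : 0 <= eta <= 2 -> eta <= circle_dist g ->
  vp_kernel d g <= (1 - eta ^+ 2 / 4) ^+ d.
Proof.
move=> /andP[e0 e2] eg; set q := 1 - _.
have q0 : 0 <= q by rewrite /q expr2; nra.
have g2 := circle_dist_le2 g.
have h : (4 - circle_dist g ^+ 2) ^+ d <= 4 ^+ d * q ^+ d.
  rewrite -exprMn lerXn2r ?nnegrE /q ?expr2; nra.
have c0 : 0 < (2 * d).+1%:R * 'C(2 * d, d)%:R :> R.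
  by rewrite -natrM ltr0n muln_gt0 /= bin_gt0; lia.
rewrite /vp_kernel mulrC ler_pdivrMr // mulrC; apply: le_trans h _.
rewrite ler_wpM2r ?exprn_ge0 // -natrX -natrM ler_nat.
exact: central_binomial_lb.
Qed.

End Kernel.

(** * Laurent approximation of orbit maps *)

Section Laurent.
Context {R : realType} {A : cstarType R}.
Implicit Types (z g : circle R) (s : seq (nat * nat * A)) (u : A).

Definition zpow z (i j : nat) : R[i] := cval z ^+ i * (cval z)^-1 ^+ j.

(** A list of triples (i, j, c) stands for the Laurent polynomial that is the
    sum of the z^(i-j) c; here it is evaluated on the circle and, in [ev_at], at an
    element of A. *)
Definition ev_circ s z : A := \sum_(m <- s) zpow z m.1.1 m.1.2 *: m.2.

(** For a unitary u this is u^(i-j). Two natural exponents avoid both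
    inverses in A and integer powers; the price is that different pairs (i, j)
    denote the same power ([umon_eq]). *)
Definition umon (i j : nat) u : A := u ^+ i * star u ^+ j.

Definition ev_at s u : A := \sum_(m <- s) umon m.1.1 m.1.2 u * m.2.

Lemma nrm_cvalV z : nrm (cval z)^-1 = 1.
Proof. by rewrite -conj_cval nrmCJ nrm_circle. Qed.

Lemma nrm_zpow z i j : nrm (zpow z i j) = 1.
Proof. by rewrite nrmCM !nrmCX nrm_circle nrm_cvalV !expr1n mulr1. Qed.

Lemma zpow_conj z i j : ((zpow z i j)^*)%R = zpow z j i.
Proof.
by rewrite /zpow rmorphM !rmorphXn /= -!conj_cval conjCK mulrC.
Qed.

Lemma zpowM z i j k l : zpow z i j * zpow z k l = zpow z (i + k) (j + l).
Proof. by rewrite /zpow !exprD mulrACA. Qed.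

Lemma zpow_mul z g i j : zpow (z * g)%g i j = zpow z i j * zpow g i j.
Proof.
rewrite /zpow [cval (_ * _)%g]/(cval z * cval g) invfM !exprMn.
by rewrite mulrACA.
Qed.

Lemma zpow_shift z i j k : zpow z (i + k) (j + k) = zpow z i j.
Proof.
by rewrite -zpowM {2}/zpow -exprMn mulfV ?cval_neq0 // expr1n mulr1.
Qed.

Lemma ev_circ_cat s s' z : ev_circ (s ++ s') z = ev_circ s z + ev_circ s' z.
Proof. exact: big_cat. Qed.

Definition laurent_shift (i j : nat) s : seq (nat * nat * A) :=
  [seq (m.1.1 + i, m.1.2 + j, m.2)%N | m <- s].

Lemma ev_circ_shift i j s z :
  ev_circ (laurent_shift i j s) z = zpow z i j *: ev_circ s z.
Proof.
rewrite /ev_circ big_map scaler_sumr; apply: eq_bigr => m _ /=.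
by rewrite scalerA zpowM (addnC i) (addnC j).
Qed.

Definition laurent_scale (c : R[i]) s : seq (nat * nat * A) :=
  [seq (m.1, c *: m.2) | m <- s].

Lemma ev_circ_scale c s z : ev_circ (laurent_scale c s) z = c *: ev_circ s z.
Proof.
rewrite /ev_circ big_map scaler_sumr; apply: eq_bigr => m _ /=.
by rewrite !scalerA mulrC.
Qed.

Definition laurent_inv s : seq (nat * nat * A) :=
  [seq (m.1.2, m.1.1, m.2) | m <- s].

Lemma ev_circ_inv s z : ev_circ (laurent_inv s) z = ev_circ s z^-1%g.
Proof.
rewrite /ev_circ big_map; apply: eq_bigr => m _ /=; congr (_ *: _).
by rewrite /zpow [cval _^-1%g]/(cval z)^-1 invrK mulrC.
Qed.

Definition approximable (G : circle R -> A) := forall e : R, 0 < e ->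
  exists s, forall z, nrm (G z - ev_circ s z) <= e.

Lemma approximable_eq G G' : G =1 G' -> approximable G -> approximable G'.
Proof. by move=> h a e /a[s hs]; exists s => z; rewrite -h. Qed.

Lemma approximable_inv G :
  approximable G -> approximable (fun z => G z^-1%g).
Proof.
by move=> a e /a[s hs]; exists (laurent_inv s) => z; rewrite ev_circ_inv.
Qed.

Lemma approximable0 : approximable (fun=> 0).
Proof.
by move=> e e0; exists [::] => z; rewrite /ev_circ big_nil subr0 nrm0 ltW.
Qed.

Lemma approximableD G G' :
  approximable G -> approximable G' -> approximable (fun z => G z + G' z).
Proof.
move=> a a' e e0; have e2 : 0 < e / 2 by lra.
have [s hs] := a _ e2; have [s' hs'] := a' _ e2.
exists (s ++ s') => z; rewrite ev_circ_cat opprD addrACA.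
by apply: le_trans (nrmD _ _) _; have := hs z; have := hs' z; lra.
Qed.

Lemma approximable_sum I (r : seq I) (G : I -> circle R -> A) :
  (forall i, approximable (G i)) ->
  approximable (fun z => \sum_(i <- r) G i z).
Proof.
move=> a; elim: r => [|i r IH].
  by apply: approximable_eq approximable0 => z; rewrite big_nil.
by apply: approximable_eq (approximableD (a i) IH) => z; rewrite big_cons.
Qed.

Lemma approximable_zpow i j G :
  approximable G -> approximable (fun z => zpow z i j *: G z).
Proof.
move=> a e /a[s hs]; exists (laurent_shift i j s) => z.
by rewrite ev_circ_shift -scalerBr nrmZ nrm_zpow mul1r.
Qed.

Lemma approximableZ (c : R[i]) G :
  approximable G -> approximable (fun z => c *: G z).
Proof.
move=> a e e0; have c1 : 0 < nrm c + 1 by have := nrm_ge0 c; lra.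
have [s hs] := a _ (divr_gt0 e0 c1); exists (laurent_scale c s) => z.
rewrite ev_circ_scale -scalerBr nrmZ.
have := hs z; rewrite ler_pdivlMr // => h.
by have := nrm_ge0 (G z - ev_circ s z); nra.
Qed.

End Laurent.

Section Orbits.
Context {R : realType} {A : cstarType R}.
Variables (alpha : cstar_action (circle R) A).
Hypothesis alpha_cont : continuous_action alpha.
Implicit Types (z g : circle R) (a : A).

Lemma act_bounded g a : nrm (alpha g a) <= 4 * nrm a.
Proof. exact: star_hom_bounded (act_star_hom alpha g) a. Qed.

(** Continuity of a single orbit map at 1. Since the action is a uniformly
    bounded group action, this already yields uniform continuity on the
    circle. *)
Lemma act_near1 a (e : R) : 0 < e -> exists2 eta : R, 0 < eta <= 2 &
  forall g, circle_dist g < eta -> nrm (alpha g a - a) <= e.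
Proof.
move=> e0; have /cvgrPdist_le/(_ e%:C) := @alpha_cont a (circle_one R).
rewrite ltcR => /(_ e0); rewrite nbhsE => -[B [[U oU UB] B1] hB].
have U1 : nbhs (1 : R[i]^o) U.
  by apply: open_nbhs_nbhs; split=> //; move: B1; rewrite -UB.
have [eta eta0 hU] := (@nbhs_ballP _ _ _ _).1 U1.
have etaE : eta = (complex.Re eta)%:C by rewrite RRe_real // gtr0_real.
have eta0' : 0 < complex.Re eta by rewrite -ltcR -etaE.
exists (Num.min 2 (complex.Re eta)) => [|g].
  by rewrite lt_min eta0' ge_min lexx ltr0n.
rewrite lt_min => /andP[_ gd].
have Bg : B g.
  rewrite -UB; apply: hU; rewrite -ball_normE /= etaE nrmE ltcR; exact: gd.
have h1 : alpha (circle_one R) a = a by exact: Defs.act1.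
by have := hB g Bg; rewrite /= nrmE lecR nrmB h1.
Qed.

(** The approximant is the average of the alpha_zeta a over the (2d+1)-st roots
    of unity zeta, weighted by the kernel at z / zeta. Nodes near z contribute
    little because the orbit map is uniformly continuous, the other ones because
    the kernel decays like q^d there. *)
Lemma approximable_orbit a : approximable (fun z => alpha z a).
Proof.
move=> e e0; have e8 : 0 < e / 8 by lra.
have [eta /andP[eta0 eta2] near1] := act_near1 a e8.
(* At a far node the two orbit points differ by at most
   4 (4 + 1) nrm a. *)
pose q := 1 - eta ^+ 2 / 4; pose M := 20 * nrm a.
have M0 : 0 <= M by rewrite mulr_ge0 // nrm_ge0.
have q01 : 0 <= q < 1 by rewrite /q !expr2; apply/andP; split; nra.
have M20 : 0 <= 2 * M by rewrite mulr_ge0.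
have e2 : 0 < e / 2 by lra.
have [d /(_ d (leqnn d)) hd] := linear_geometric_decay q01 M20 M0 e2.
pose K : R[i] := ((2 * d).+1%:R * 'C(2 * d, d)%:R)^-1.
pose s : seq (nat * nat * A) := [seq (nat_of_ord t, d,
    (K * 'C(2 * d, t)%:R * zpow (rt l)^-1%g t d) *: alpha (rt l) a)
  | l : 'I_(2 * d).+1 <- index_enum _, t : 'I_(2 * d).+1 <- index_enum _].
have sE z : ev_circ s z =
    \sum_(l < (2 * d).+1) (vp_kernel d (z * (rt l)^-1)%g)%:C *: alpha (rt l) a.
  rewrite /ev_circ big_allpairs_dep /=; apply: eq_bigr => l _.
  rewrite vp_kernelE scaler_suml; apply: eq_bigr => t _; rewrite scalerA.
  congr (_ *: _); rewrite -/K -/(zpow _ _ _) zpow_mul; ring.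
exists s => z; rewrite sE nrmB.
have -> : alpha z a = \sum_(l < (2 * d).+1) (vp_kernel d (z * (rt l)^-1)%g)%:C *: alpha z a.
  by rewrite -scaler_suml -(rmorph_sum (real_complex R)) vp_kernel_sum scale1r.
rewrite -sumrB; under eq_bigr => l _ do rewrite -scalerBr.
apply: le_trans (nrm_sum_real _ _ (fun l => vp_kernel_ge0 d _)) _.
apply: (@le_trans _ _ (\sum_(l < (2 * d).+1)
    (vp_kernel d (z * (rt l)^-1)%g * (e / 2) + q ^+ d * M))).
  apply: ler_sum => l _; set g := (z * (rt l)^-1)%g.
  have zE : alpha z a = alpha (rt l) (alpha g a).
    rewrite -Defs.actM; congr (alpha _ a); apply: cval_inj.
    suff : cval z = cval (rt l) * (cval z / cval (rt l)) by [].
    by rewrite GRing.mulrC divfK // cval_neq0.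
  have k0 := vp_kernel_ge0 d g.
  have q0 : 0 <= q ^+ d by rewrite exprn_ge0 //; case/andP: q01.
  have act_diff : nrm (alpha (rt l) a - alpha z a) <= 4 * nrm (alpha g a - a).
    rewrite zE -(star_homB (act_star_hom alpha (rt l))) nrmB.
    by rewrite nrmB; apply: le_trans (act_bounded _ _) _; rewrite nrmB.
  have := nrm_ge0 (alpha (rt l) a - alpha z a).
  case: (ltP (circle_dist g) eta) => gd.
    have qM : 0 <= q ^+ d * M by rewrite mulr_ge0.
    move=> D0; apply: (@le_trans _ _ (vp_kernel d g * (e / 2))); last by rewrite lerDl.
    by rewrite ler_wpM2l //; have := near1 _ gd; lra.
  have eta02 : 0 <= eta <= 2 by rewrite (ltW eta0) eta2.
  have := vp_kernel_far d eta02 gd; rewrite -/q.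
  have : nrm (alpha g a - a) <= 5 * nrm a.
    by apply: le_trans (nrmD _ _) _; rewrite nrmN; have := act_bounded g a; lra.
  move=> a5 kq D0; have ke : 0 <= vp_kernel d g * (e / 2).
    by rewrite mulr_ge0 // ltW.
  apply: (@le_trans _ _ (q ^+ d * M)); last by rewrite lerDr.
  by apply: ler_pM => //; rewrite /M; lra.
rewrite big_split /= -mulr_suml vp_kernel_sum sumr_const card_ord mul1r.
rewrite -[X in _ + X]mulr_natl -[(2 * d).+1%:R]natr1 natrM; move: hd; lra.
Qed.

End Orbits.

(** * Rokhlin unitaries *)

Section RokhlinUnitaries.
Context {R : realType} {A : cstarType R}.
Variable alpha : cstar_action (circle R) A.
Implicit Types (u a : A) (z : circle R) (X Y : A -> A).

(** The filter generated by the sets of Rokhlin unitaries for a finite set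
    S and a tolerance d. Statements about it read: for every u that is chosen
    after, and suitably adapted to, the other data. *)
Definition rokhlin_unitaries : set_system A := fun P =>
  exists (S : seq A) (d : R), 0 < d /\
    forall u, unitary u ->
      (forall z, nrm (alpha z u - cval z *: u) < d) ->
      (forall a, a \in S -> nrm (u * a - a * u) < d) -> P u.

Lemma rokhlin_unitaries_filter : Filter rokhlin_unitaries.
Proof.
split.
- by exists [::], 1; split=> // u.
- move=> P Q [S [d [d0 h]]] [S' [d' [d'0 h']]].
  exists (S ++ S'), (Num.min d d'); split; first by rewrite lt_min d0.
  move=> u uU uz uS; split.
  + apply: h => // [z|a aS]; first by have := uz z; rewrite lt_min => /andP[].
    have : a \in S ++ S' by rewrite mem_cat aS.
    by move=> /uS; rewrite lt_min => /andP[].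
  + apply: h' => // [z|a aS]; first by have := uz z; rewrite lt_min => /andP[].
    have : a \in S ++ S' by rewrite mem_cat aS orbT.
    by move=> /uS; rewrite lt_min => /andP[].
- move=> P Q PQ [S [d [d0 h]]]; exists S, d; split=> // u uU uz uS.
  by apply: PQ; exact: h.
Qed.

Local Existing Instance rokhlin_unitaries_filter.
Local Notation F := rokhlin_unitaries.

Lemma rokhlin_unitaries_ex (P : A -> Prop) : rokhlin_circle alpha ->
  (\forall u \near F, P u) -> exists u, P u.
Proof.
move=> rok [S [d [d0 h]]].
have d0' : 0 < d%:C by rewrite ltcR.
have [u [uU uz uS]] := rok [set` S] d%:C (finite_seq S) d0'.
exists u; apply: h => // [z|a aS].
  by rewrite -ltcR -nrmE.
by rewrite -ltcR -nrmE; exact: uS.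
Qed.

Lemma near_unitary : \forall u \near F, unitary u.
Proof. by exists [::], 1; split. Qed.

Definition vanish X := forall e : R, 0 < e -> \forall u \near F, nrm (X u) <= e.

Definition bounded X := exists B : R, \forall u \near F, nrm (X u) <= B.

Lemma vanish_eq X Y : (\forall u \near F, X u = Y u) -> vanish X -> vanish Y.
Proof. by move=> h v e /v; apply: filterS2 h => u -> . Qed.

Lemma vanish_bounded X : vanish X -> bounded X.
Proof. by move=> /(_ 1 ltr01) h; exists 1. Qed.

Lemma vanish0 : vanish (fun=> 0).
Proof. by move=> e e0; apply: filterE => u; rewrite nrm0 ltW. Qed.

Lemma vanishD X Y : vanish X -> vanish Y -> vanish (fun u => X u + Y u).
Proof.
move=> vX vY e e0; have e2 : 0 < e / 2 by lra.
apply: filterS2 (vX _ e2) (vY _ e2) => u hX hY.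
by apply: le_trans (nrmD _ _) _; lra.
Qed.

Lemma vanishN X : vanish X -> vanish (fun u => - X u).
Proof. by move=> v e /v; apply: filterS => u; rewrite nrmN. Qed.

Lemma vanish_star X : vanish X -> vanish (fun u => star (X u)).
Proof. by move=> v e /v; apply: filterS => u; rewrite nrm_star. Qed.

Lemma vanishM_l X Y : bounded X -> vanish Y -> vanish (fun u => X u * Y u).
Proof.
move=> [B hB] vY e e0; have B1 : 0 < `|B| + 1 by have := normr_ge0 B; lra.
apply: filterS2 hB (vY _ (divr_gt0 e0 B1)) => u hB' hY.
apply: le_trans (nrmM_le _ hY) (_ : (`|B| + 1) * (e / (`|B| + 1)) <= e).
  by apply: le_trans hB' _; have := ler_norm B; lra.
by rewrite mulrC divfK // gt_eqF.
Qed.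

Lemma vanishM_r X Y : vanish X -> bounded Y -> vanish (fun u => X u * Y u).
Proof.
move=> vX [B hB] e e0; have B1 : 0 < `|B| + 1 by have := normr_ge0 B; lra.
apply: filterS2 hB (vX _ (divr_gt0 e0 B1)) => u hB' hX.
apply: le_trans (nrmM_le hX _) (_ : (e / (`|B| + 1)) * (`|B| + 1) <= e).
  by apply: le_trans hB' _; have := ler_norm B; lra.
by rewrite divfK // gt_eqF.
Qed.

Lemma vanish_sum I (r : seq I) (X : I -> A -> A) :
  (forall i, vanish (X i)) -> vanish (fun u => \sum_(i <- r) X i u).
Proof.
move=> v; elim: r => [|i r IH].
  by apply: vanish_eq vanish0; apply: filterE => u; rewrite big_nil.
by apply: vanish_eq (vanishD (v i) IH); apply: filterE => u; rewrite big_cons.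
Qed.

Lemma bounded_cst a : bounded (fun=> a).
Proof. by exists (nrm a); apply: filterE. Qed.

Lemma boundedD X Y : bounded X -> bounded Y -> bounded (fun u => X u + Y u).
Proof.
move=> [B hB] [C hC]; exists (B + C); apply: filterS2 hB hC => u b c.
by apply: le_trans (nrmD _ _) _; exact: lerD.
Qed.

Lemma boundedM X Y : bounded X -> bounded Y -> bounded (fun u => X u * Y u).
Proof.
move=> [B hB] [C hC]; exists (B * C); apply: filterS2 hB hC => u b c.
exact: nrmM_le.
Qed.

Lemma bounded_sum I (r : seq I) (X : I -> A -> A) :
  (forall i, bounded (X i)) -> bounded (fun u => \sum_(i <- r) X i u).
Proof.
move=> v; elim: r => [|i r [C IH]].
  by exists 0; apply: filterE => u; rewrite big_nil nrm0.
have [B hB] := v i; exists (B + C); apply: filterS2 hB IH => u b c.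
by rewrite big_cons; apply: le_trans (nrmD _ _) _; exact: lerD.
Qed.

Lemma nrm_umon i j u : unitary u -> nrm (umon i j u) <= 1.
Proof.
move=> uU; have u1 := nrm_unitary uU; rewrite -[1]mulr1.
by apply: nrmM_le; apply: nrmX_le1; rewrite ?nrm_star.
Qed.

Lemma bounded_umon i j : bounded (umon i j).
Proof. by exists 1; apply: filterS near_unitary => u; exact: nrm_umon. Qed.

Lemma star_pow_comm i j u : unitary u ->
  star u ^+ j * u ^+ i = u ^+ i * star u ^+ j.
Proof.
move=> [uu' u'u]; have c : GRing.comm (star u) u by rewrite /GRing.comm uu'.
exact/commrX/commr_sym/commrX/commr_sym.
Qed.

Lemma umonM i j k l u : unitary u ->
  umon i j u * umon k l u = umon (i + k) (j + l) u.
Proof.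
move=> uU; rewrite /umon !exprD mulrA -[_ * _ * u ^+ k]mulrA star_pow_comm //.
by rewrite !mulrA.
Qed.

Lemma umon_shift i j k u : unitary u -> umon (i + k) (j + k) u = umon i j u.
Proof.
move=> uU; rewrite -umonM //; suff -> : umon k k u = 1 by rewrite mulr1.
have [uu' u'u] := uU; rewrite /umon; elim: k => [|k IH].
  by rewrite !expr0 mulr1.
by rewrite exprS exprSr mulrA -(mulrA u) IH mulr1.
Qed.

(** Pairs of exponents with the same difference give the same power of
    u. *)
Lemma umon_eq i j k l u : unitary u -> (i + l = k + j)%N ->
  umon i j u = umon k l u.
Proof.
move=> uU h; have [ik|ki] := leqP i k.
  have -> : k = (i + (k - i))%N by lia.
  have -> : l = (j + (k - i))%N by lia.
  by rewrite umon_shift.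
have -> : i = (k + (i - k))%N by lia.
have -> : j = (l + (i - k))%N by lia.
by rewrite umon_shift.
Qed.

Lemma umon_star i j u : unitary u -> star (umon i j u) = umon j i u.
Proof. by move=> uU; rewrite /umon csM !starX starK. Qed.

Lemma vanish_commX X a : vanish (fun u => X u * a - a * X u) -> bounded X ->
  forall k, vanish (fun u => X u ^+ k * a - a * X u ^+ k) /\
            bounded (fun u => X u ^+ k).
Proof.
move=> v b; elim=> [|k [IHv IHb]].
  split; last exact: bounded_cst.
  apply: vanish_eq vanish0; apply: filterE => u.
  by rewrite expr0 mulr1 mul1r subrr.
split; last first.
  have [B hB] := boundedM b IHb; exists B; apply: filterS hB => u.
  by rewrite exprS.
apply: vanish_eq (vanishD (vanishM_l b IHv) (vanishM_r v IHb)).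
apply: filterE => u; rewrite exprS mulrBr mulrBl -!mulrA.
by rewrite addrA subrK mulrA.
Qed.

Lemma vanish_comm_u a : vanish (fun u => u * a - a * u).
Proof.
move=> e e0; exists [:: a], e; split=> // u uU _ ua.
by apply: ltW; apply: ua; rewrite inE.
Qed.

Lemma bounded_u : bounded id.
Proof. by exists 1; apply: filterS near_unitary => u; exact: nrm_unitary. Qed.

Lemma bounded_star_u : bounded star.
Proof.
by exists 1; apply: filterS near_unitary => u; rewrite nrm_star; exact: nrm_unitary.
Qed.

Lemma vanish_comm_star_u a : vanish (fun u => star u * a - a * star u).
Proof.
apply: vanish_eq (vanishN (vanish_star (vanish_comm_u (star a)))).
by apply: filterE => u; rewrite starB !csM starK opprB.
Qed.

Lemma vanish_comm_umon i j a : vanish (fun u => umon i j u * a - a * umon i j u).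
Proof.
have [v b] := vanish_commX (vanish_comm_u a) bounded_u i.
have [v' b'] := vanish_commX (vanish_comm_star_u a) bounded_star_u j.
apply: vanish_eq (vanishD (vanishM_l b v') (vanishM_r v b')).
apply: filterE => u; rewrite /umon mulrBr mulrBl -!mulrA.
by rewrite addrA subrK.
Qed.

End RokhlinUnitaries.

(** * Evaluation of Laurent polynomials at Rokhlin unitaries *)

Section Symbols.
Context {R : realType} {A : cstarType R}.
Variable alpha : cstar_action (circle R) A.
Implicit Types (u a : A) (z : circle R) (X Y : A -> A) (G H : circle R -> A).
Implicit Types (s : seq (nat * nat * A)).
Local Existing Instance rokhlin_unitaries_filter.
Local Notation F := (rokhlin_unitaries alpha).
Local Notation vanish := (vanish alpha).
Local Notation bounded := (bounded alpha).

Definition deg_le (d : nat) s := all (fun m => (m.1.1 <= d) && (m.1.2 <= d))%N s.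

Definition laurent_mul s s' : seq (nat * nat * A) :=
  [seq ((m.1.1 + m'.1.1)%N, (m.1.2 + m'.1.2)%N, m.2 * m'.2) | m <- s, m' <- s'].

Definition laurent_star s : seq (nat * nat * A) :=
  [seq (m.1.2, m.1.1, star m.2) | m <- s].

Lemma deg_le_mul d d' s s' : deg_le d s -> deg_le d' s' ->
  deg_le (d + d') (laurent_mul s s').
Proof.
move=> /allP h /allP h'; apply/allP => m /allpairsP[[p p'] /= [ps ps' ->]] /=.
have /andP[h1 h2] := h _ ps; have /andP[h3 h4] := h' _ ps'.
by rewrite !leq_add.
Qed.

Lemma deg_le_star d s : deg_le d s -> deg_le d (laurent_star s).
Proof. by rewrite /deg_le all_map; apply: sub_all => m /=; rewrite andbC. Qed.

Lemma ev_circ_mul s s' z :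
  ev_circ (laurent_mul s s') z = ev_circ s z * ev_circ s' z.
Proof.
rewrite /ev_circ big_allpairs_dep /= mulr_suml; apply: eq_bigr => m _.
by rewrite mulr_sumr; apply: eq_bigr => m' _; rewrite csZM zpowM.
Qed.

Lemma ev_circ_star s z : ev_circ (laurent_star s) z = star (ev_circ s z).
Proof.
rewrite /ev_circ big_map star_sum; apply: eq_bigr => m _.
by rewrite starZ zpow_conj.
Qed.

Lemma bounded_ev_at s : bounded (ev_at s).
Proof.
by apply: bounded_sum => m; apply: boundedM (bounded_umon _ _ _) (bounded_cst _ _).
Qed.

Lemma ev_at_mul s s' :
  vanish (fun u => ev_at s u * ev_at s' u - ev_at (laurent_mul s s') u).
Proof.
apply: (vanish_eq _ (vanish_sum s (fun m => vanish_sum s' (fun m' =>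
   vanishM_l (bounded_umon alpha m.1.1 m.1.2)
     (vanishM_r (vanishN (vanish_comm_umon alpha m'.1.1 m'.1.2 m.2))
        (bounded_cst alpha m'.2)))))).
apply: filterS (near_unitary alpha) => u uU.
rewrite /ev_at big_allpairs_dep /= mulr_suml -sumrB; apply: eq_bigr => m _.
rewrite mulr_sumr -sumrB; apply: eq_bigr => m' _.
by rewrite -umonM // opprB mulrBl mulrBr !mulrA.
Qed.

Lemma ev_at_star s :
  vanish (fun u => star (ev_at s u) - ev_at (laurent_star s) u).
Proof.
apply: (vanish_eq _ (vanish_sum s (fun m =>
   vanishN (vanish_comm_umon alpha m.1.2 m.1.1 (star m.2))))).
apply: filterS (near_unitary alpha) => u uU.
rewrite /ev_at big_map star_sum -sumrB; apply: eq_bigr => m _.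
by rewrite opprB csM umon_star.
Qed.

(** Lagrange basis for Laurent polynomials of degree at most D, taken at the
    (2D+1)-st roots of unity: the value at z is
    (1/(2D+1)) sum_(|k| <= D) (z / zeta_l)^k, written with k = t - D. *)
Definition interp (D : nat) (l : 'I_(2 * D).+1) u : A :=
  \sum_(t < (2 * D).+1) ((2 * D).+1%:R^-1 * zpow (rt l) D t) *: umon t D u.

Lemma nrm_interp D l u : unitary u -> nrm (@interp D l u) <= 1.
Proof.
move=> uU; apply: le_trans (nrm_sum _ _ _) _.
apply: (@le_trans _ _ (\sum_(t < (2 * D).+1) (2 * D).+1%:R^-1)).
  apply: ler_sum => t _; rewrite nrmZ nrmCM nrm_zpow mulr1.
  have -> : (2 * D).+1%:R^-1 = ((2 * D).+1%:R^-1 : R)%:C :> R[i].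
    by rewrite fmorphV rmorph_nat.
  rewrite nrm_real ger0_norm ?invr_ge0 //.
  by rewrite ler_piMr ?invr_ge0 // nrm_umon.
by rewrite sumr_const card_ord -[leLHS]mulr_natl mulfV // pnatr_eq0.
Qed.

Lemma ev_at_interp D s u : unitary u -> deg_le D s ->
  ev_at s u = \sum_(l < (2 * D).+1) interp l u * ev_circ s (rt l).
Proof.
move=> uU /allP sD; rewrite /ev_circ.
under [RHS]eq_bigr => l _ do rewrite mulr_sumr.
rewrite exchange_big /= /ev_at; apply: eq_big_seq => m /sD /andP[iD jD].
move: m.1.1 m.1.2 m.2 iD jD => i j c iD jD {sD m}.
have term (l t : 'I_(2 * D).+1) :
    ((2 * D).+1%:R^-1 * zpow (rt l) D t) *: umon t D u * (zpow (rt l) i j *: c) =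
    ((2 * D).+1%:R^-1 * zpow (rt l) (i + (D - j)) t) *: (umon t D u * c).
  rewrite csZM -mulrA zpowM; congr ((_ * _) *: _).
  by rewrite -[RHS](zpow_shift _ _ _ j); congr zpow; lia.
under eq_bigr => l _.
  rewrite mulr_suml; under eq_bigr => t _ do rewrite term.
  over.
rewrite exchange_big /=.
under eq_bigr => t _.
  rewrite -scaler_suml -mulr_sumr rt_sum; [|lia|by rewrite -ltnS].
  over.
have kD : (i + (D - j) < (2 * D).+1)%N by lia.
rewrite (bigD1 (Ordinal kD)) //= big1 ?addr0 => [|t tk].
  rewrite eqxx mulr1 mulVf ?pnatr_eq0 // scale1r.
  by congr (_ * _); apply: umon_eq => //; lia.
by rewrite -val_eqE /= eq_sym in tk; rewrite (negbTE tk) !mulr0 scale0r.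
Qed.

(** A crude bound, valid for every unitary u. Its constant grows only
    linearly with the degree, which is what [symbol_norm] needs. *)
Lemma nrm_ev_at D s u (S : R) : unitary u -> deg_le D s ->
  (forall z, nrm (ev_circ s z) <= S) ->
  nrm (ev_at s u) <= (2 * D).+1%:R * S.
Proof.
move=> uU sD hS; rewrite (ev_at_interp uU sD).
apply: le_trans (nrm_sum _ _ _) _.
have -> : (2 * D).+1%:R * S = \sum_(l < (2 * D).+1) S.
  by rewrite sumr_const card_ord -[RHS]mulr_natl.
apply: ler_sum => l _; rewrite -[S]mul1r.
exact: nrmM_le (nrm_interp _ uU) (hS _).
Qed.

(** X is a function of the Rokhlin unitary u that vanishingly differs from G(u),
    for a Laurent polynomial G of degree at most d. The degree is recorded
    because it controls the constant in [nrm_ev_at]. *)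
Definition symbol (d : nat) G X := exists s, [/\ deg_le d s,
  forall z, G z = ev_circ s z & vanish (fun u => X u - ev_at s u)].

Lemma symbol_bounded d G X : symbol d G X -> bounded X.
Proof.
case=> s [_ _ v].
have [B hB] := boundedD (vanish_bounded v) (bounded_ev_at s).
by exists B; apply: filterS hB => u; rewrite subrK.
Qed.

Lemma symbol_ev d s : deg_le d s -> symbol d (ev_circ s) (ev_at s).
Proof.
move=> sd; exists s; split=> //; apply: vanish_eq (vanish0 _).
by apply: filterE => u; rewrite subrr.
Qed.

Lemma symbol_cst d a : symbol d (fun=> a) (fun=> a).
Proof.
exists [:: (0, 0, a)%N]; split=> // [z|].
  by rewrite /ev_circ big_seq1 /zpow !expr0 mulr1 scale1r.
apply: vanish_eq (vanish0 _); apply: filterE => u.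
by rewrite /ev_at big_seq1 /umon !expr0 !mul1r subrr.
Qed.

(** Products are compatible because u commutes in the limit with the
    coefficients of the Laurent polynomials. *)
Lemma symbolM d d' G G' X X' : symbol d G X -> symbol d' G' X' ->
  symbol (d + d') (fun z => G z * G' z) (fun u => X u * X' u).
Proof.
move=> sX sX'; have bX' := symbol_bounded sX'.
have [s [sd Gs v]] := sX; have [s' [sd' Gs' v']] := sX'.
exists (laurent_mul s s'); split; first exact: deg_le_mul.
  by move=> z; rewrite ev_circ_mul Gs Gs'.
apply: vanish_eq (vanishD (vanishD (vanishM_r v bX')
   (vanishM_l (bounded_ev_at s) v')) (ev_at_mul s s')).
by apply: filterE => u; rewrite mulrBl mulrBr !addrA !subrK.
Qed.

Lemma symbolJ d G X : symbol d G X ->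
  symbol d (fun z => star (G z)) (fun u => star (X u)).
Proof.
move=> [s [sd Gs v]]; exists (laurent_star s); split; first exact: deg_le_star.
  by move=> z; rewrite ev_circ_star Gs.
apply: vanish_eq (vanishD (vanish_star v) (ev_at_star s)).
by apply: filterE => u; rewrite starB addrA subrK.
Qed.

Lemma symbol_leq d d' G X : (d <= d')%N -> symbol d G X -> symbol d' G X.
Proof.
move=> dd [s [sd Gs v]]; exists s; split=> //.
by apply: sub_all sd => m /andP[h h']; rewrite !(leq_trans _ dd).
Qed.

Lemma symbolD d G G' X X' : symbol d G X -> symbol d G' X' ->
  symbol d (fun z => G z + G' z) (fun u => X u + X' u).
Proof.
move=> [s [sd Gs v]] [s' [sd' Gs' v']]; exists (s ++ s'); split.
- by rewrite /deg_le all_cat; apply/andP.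
- by move=> z; rewrite ev_circ_cat Gs Gs'.
- apply: vanish_eq (vanishD v v'); apply: filterE => u.
  by rewrite /ev_at big_cat opprD addrACA.
Qed.

Lemma symbolZ d (c : R[i]) G X : symbol d G X ->
  symbol d (fun z => c *: G z) (fun u => c *: X u).
Proof.
move=> h; have := symbolM (symbol_cst 0 (c *: (1 : A))) h; rewrite add0n.
move=> [s [sd Gs v]]; exists s; split=> // [z|].
  by rewrite -Gs csZl mul1r.
by apply: vanish_eq v; apply: filterE => u; rewrite csZl mul1r.
Qed.

Lemma symbolB d G G' X X' : symbol d G X -> symbol d G' X' ->
  symbol d (fun z => G z - G' z) (fun u => X u - X' u).
Proof.
move=> h /(symbolZ (-1)) h'; have [s [sd Gs v]] := symbolD h h'.
exists s; split=> // [z|]; first by rewrite -Gs scaleN1r.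
by apply: vanish_eq v; apply: filterE => u; rewrite scaleN1r.
Qed.

Lemma symbol_sum d I (r : seq I) (G : I -> circle R -> A) (X : I -> A -> A) :
  (forall i, symbol d (G i) (X i)) ->
  symbol d (fun z => \sum_(i <- r) G i z) (fun u => \sum_(i <- r) X i u).
Proof.
move=> h; elim: r => [|i r IH].
  have [s [sd Gs v]] := symbol_cst d 0; exists s; split=> // [z|].
    by rewrite -Gs big_nil.
  by apply: vanish_eq v; apply: filterE => u; rewrite big_nil.
have [s [sd Gs v]] := symbolD (h i) IH; exists s; split=> // [z|].
  by rewrite -Gs big_cons.
by apply: vanish_eq v; apply: filterE => u; rewrite big_cons.
Qed.

Lemma symbolX d G X k : symbol d G X ->
  symbol (k * d) (fun z => G z ^+ k) (fun u => X u ^+ k).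
Proof.
move=> h; elim: k => [|k IH].
  exact: (symbol_cst 0 1).
have [s [sd Gs v]] := symbolM h IH; exists s; split=> // [z|].
  by rewrite -Gs exprS.
by apply: vanish_eq v; apply: filterE => u; rewrite exprS.
Qed.

Lemma nrm_sa_pow2 (h : A) k : star h = h ->
  nrm (h ^+ (2 ^ k)) = nrm h ^+ (2 ^ k).
Proof.
move=> hs; elim: k => [|k IH]; first by rewrite !expn0 !expr1.
rewrite expnSr !exprM -IH expr2 -nrm_sa_sqr //.
by rewrite starX hs.
Qed.

Lemma nrm_pow_le (x : A) (S : R) k : 0 <= S -> nrm x <= S -> (0 < k)%N ->
  nrm (x ^+ k) <= S ^+ k.
Proof.
move=> S0 xS; case: k => // k _; elim: k => [|k IH]; first by rewrite !expr1.
by rewrite exprS [leRHS]exprS; apply: nrmM_le.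
Qed.

(** Apply the crude bound to (X^* X)^m instead of X. By the C*-identity its norm
    is that of X to the power 2m, when m is a power of 2; the symbol is bounded by
    S^(2m) and has degree proportional to m. So nrm X is at most S times the
    2m-th root of a linear expression in m, which tends to S. *)
Lemma symbol_norm d G X (S e : R) : symbol d G X -> 0 <= S -> 0 < e ->
  (forall z, nrm (G z) <= S) -> \forall u \near F, nrm (X u) <= S + e.
Proof.
(* Since S < S1, the crude bound is at most half of S1^(2m) for large m; the
   other half is left for the vanishing error. *)
move=> sX S0 e0 GS; pose S1 := S + e; have S10 : 0 < S1 by rewrite /S1; lra.
pose q := (S / S1) ^+ 2.
have r01 : 0 <= S / S1 < 1.
  by rewrite divr_ge0 ?(ltW S10) //= ltr_pdivrMr // mul1r /S1; lra.
have q01 : 0 <= q < 1.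
  by rewrite /q expr2; case/andP: r01 => ? ?; apply/andP; split; nra.
have d0 : 0 <= 4 * d%:R :> R by rewrite mulr_ge0.
have [|M hM] := @linear_geometric_decay _ q (4 * d%:R) 1 2^-1 q01 d0 ler01.
  by rewrite invr_gt0.
pose m := (2 ^ M)%N; have Mm : (M <= m)%N by apply/ltnW/ltn_expl.
have m0 : (0 < m)%N by rewrite expn_gt0.
have [s [sd Hs v]] := symbolX m (symbolM (symbolJ sX) sX).
have e'0 : 0 < S1 ^+ (2 * m) / 2 by rewrite divr_gt0 // exprn_gt0.
apply: filterS2 (near_unitary alpha) (v _ e'0) => u uU Xs.
have Hb z : nrm (ev_circ s z) <= S ^+ (2 * m).
  rewrite -Hs exprM; apply: nrm_pow_le => //; first exact: sqr_ge0.
  by rewrite nrm_cstar lerXn2r ?nnegrE // nrm_ge0.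
have := nrm_ev_at uU sd Hb.
have : nrm (X u) ^+ (2 * m) = nrm ((star (X u) * X u) ^+ m).
  by rewrite nrm_sa_pow2 ?csM ?starK // nrm_cstar exprM.
have := nrm_le_sub ((star (X u) * X u) ^+ m) (ev_at s u).
have SE : S ^+ (2 * m) = S1 ^+ (2 * m) * q ^+ m.
  by rewrite /q -exprM -exprMn mulrC divfK // gt_eqF.
have coef : (2 * (m * (d + d))).+1%:R = 4 * d%:R * m%:R + 1 :> R.
  by rewrite -natr1 -!natrM; congr (_%:R + 1); lia.
have := hM m Mm; rewrite SE coef.
have : 0 < S1 ^+ (2 * m) by rewrite exprn_gt0.
move: Xs; set T := S1 ^+ _; set C := (_ + 1) => Xs T0 hC h1 h2 h3.
have h4 : nrm (X u) ^+ (2 * m) <= T.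
  rewrite h2; apply: le_trans h1 _.
  have : T * (C * q ^+ m) <= T * 2^-1 by rewrite ler_pM2l.
  lra.
have m20 : (0 < 2 * m)%N by rewrite muln_gt0.
by move: h4; rewrite /T ler_pXn2r ?nnegrE ?nrm_ge0 ?(ltW S10).
Qed.

End Symbols.

Section Rotation.
Context {R : realType} {A : cstarType R}.
Variable alpha : cstar_action (circle R) A.
Implicit Types (u a : A) (z g : circle R) (s : seq (nat * nat * A)).
Local Existing Instance rokhlin_unitaries_filter.

(** The Laurent polynomial z |-> alpha_g (G (z g)). As alpha_g u is close to
    g u, its value at u is close to alpha_g (G u). *)
Definition rotate g s : seq (nat * nat * A) :=
  [seq (m.1, zpow g m.1.1 m.1.2 *: alpha g m.2) | m <- s].

Lemma deg_le_rotate d g s : deg_le d s -> deg_le d (rotate g s).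
Proof. by rewrite /deg_le all_map; apply: sub_all. Qed.

Lemma rotateM g h s : rotate (g * h)%g s = rotate g (rotate h s).
Proof.
rewrite /rotate -map_comp; apply: eq_map => m /=; congr (_, _).
by rewrite (star_homZ (act_star_hom alpha g)) scalerA Defs.actM zpow_mul.
Qed.

Lemma ev_circ_rotate g s z :
  ev_circ (rotate g s) z = alpha g (ev_circ s (z * g)%g).
Proof.
have ah := act_star_hom alpha g.
rewrite /ev_circ big_map (star_hom_sum ah); apply: eq_bigr => m _ /=.
by rewrite (star_homZ ah) scalerA zpow_mul.
Qed.

Lemma vanish_act_pow g k :
  vanish alpha (fun u => alpha g u ^+ k - (cval g *: u) ^+ k).
Proof.
have ah := act_star_hom alpha g.
have unit_act u : unitary u -> unitary (alpha g u).
  by move=> [h h']; split; rewrite -(star_homJ ah) -(star_homM ah) ?h ?h' (star_hom1 ah).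
have v : vanish alpha (fun u => alpha g u - cval g *: u).
  move=> e e0; exists [::], e; split=> // u _ uz _; exact: ltW.
elim: k => [|k IH].
  by apply: vanish_eq (vanish0 _); apply: filterE => u; rewrite subrr.
have b1 : bounded alpha (fun u => alpha g u).
  exists 1; apply: filterS (near_unitary alpha) => u uU.
  exact/nrm_unitary/unit_act.
have b2 : bounded alpha (fun u => (cval g *: u) ^+ k).
  exists 1; apply: filterS (near_unitary alpha) => u uU.
  by apply: nrmX_le1; rewrite nrmZ nrm_circle mul1r; exact: nrm_unitary.
apply: vanish_eq (vanishD (vanishM_l b1 IH) (vanishM_r v b2)).
apply: filterE => u; rewrite !exprS mulrBr mulrBl addrA.
by rewrite subrK.
Qed.

Lemma vanish_act_ev_at g s :
  vanish alpha (fun u => alpha g (ev_at s u) - ev_at (rotate g s) u).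
Proof.
have ah := act_star_hom alpha g.
have term (m : nat * nat * A) : vanish alpha (fun u =>
    alpha g (umon m.1.1 m.1.2 u) - zpow g m.1.1 m.1.2 *: umon m.1.1 m.1.2 u).
  move: m.1.1 m.1.2 => i j.
  have b1 : bounded alpha (fun u => alpha g u ^+ i).
    exists (4 * 1); apply: filterS (near_unitary alpha) => u uU.
    rewrite -(star_homX ah); apply: le_trans (act_bounded _ _ _) _.
    by rewrite ler_pM2l // nrmX_le1 // nrm_unitary.
  have b2 : bounded alpha (fun u => star ((cval g *: u) ^+ j)).
    exists 1; apply: filterS (near_unitary alpha) => u uU; rewrite nrm_star.
    by apply: nrmX_le1; rewrite nrmZ nrm_circle mul1r; exact: nrm_unitary.
  apply: vanish_eq (vanishD (vanishM_l b1 (vanish_star (vanish_act_pow g j)))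
    (vanishM_r (vanish_act_pow g i) b2)).
  apply: filterE => u; rewrite starB mulrBr mulrBl addrA subrK.
  rewrite /umon (star_homM ah) !(star_homX ah) (star_homJ ah) !starX; congr (_ - _).
  by rewrite starZ conj_cval !csXZ csZM.
apply: (vanish_eq _ (vanish_sum s (fun m =>
  vanishM_r (term m) (bounded_cst alpha (alpha g m.2))))).
apply: filterE => u; rewrite /ev_at big_map (star_hom_sum ah) -sumrB.
apply: eq_bigr => m _ /=; rewrite mulrBl (star_homM ah).
by rewrite csZl csZr.
Qed.

End Rotation.

(** * Almost central matrix units *)

Section AsymptoticallyCentral.
Context {R : realType}.

Lemma dense_nrm (A : cstarType R) (S : set A) (x : A) (e : R) :
  dense S -> 0 < e -> exists2 y, S y & nrm (x - y) <= e.
Proof.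
move=> dS e0; have eC : 0 < e%:C by rewrite ltcR.
have [||y [By Sy]] := dS (ball x e%:C)^°.
- by exists x; exact: nbhsx_ballx.
- exact: open_interior.
exists y => //; have := interior_subset By.
by rewrite -ball_normE /= nrmE ltcR => /ltW.
Qed.

Section Closure.
Context {A : cstarType R} {I : Type}.
Variable E : nat -> I -> A.
Hypothesis E1 : forall k i, nrm (E k i) <= 1.
Implicit Types x y : A.

(** E is a sequence of families in the unit ball of A, to be thought of as the
    matrix units of the successive tensor factors. *)
Definition asymp_commutes x := forall e : R, 0 < e ->
  exists m, forall k, (m <= k)%N -> forall i, nrm (E k i * x - x * E k i) <= e.

Lemma asymp_commutes_exact x m :
  (forall k, (m <= k)%N -> forall i, E k i * x = x * E k i) ->
  asymp_commutes x.
Proof.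
by move=> h e e0; exists m => k mk i; rewrite h // subrr nrm0 ltW.
Qed.

Lemma asymp_commutesD x y :
  asymp_commutes x -> asymp_commutes y -> asymp_commutes (x + y).
Proof.
move=> cx cy e e0; have e2 : 0 < e / 2 by lra.
have [m hm] := cx _ e2; have [m' hm'] := cy _ e2.
exists (maxn m m') => k; rewrite geq_max => /andP[/hm h /hm' h'] i.
rewrite mulrDr mulrDl opprD addrACA; apply: le_trans (nrmD _ _) _.
by have := h i; have := h' i; lra.
Qed.

Lemma asymp_commutesM x y :
  asymp_commutes x -> asymp_commutes y -> asymp_commutes (x * y).
Proof.
move=> cx cy e e0; pose B := nrm x + nrm y + 1.
have B0 : 0 < B by rewrite /B; have := nrm_ge0 x; have := nrm_ge0 y; lra.
have [m hm] := cx _ (divr_gt0 e0 B0); have [m' hm'] := cy _ (divr_gt0 e0 B0).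
exists (maxn m m') => k; rewrite geq_max => /andP[/hm h /hm' h'] i.
have -> : E k i * (x * y) - x * y * E k i =
    (E k i * x - x * E k i) * y + x * (E k i * y - y * E k i).
  by rewrite mulrBl mulrBr !mulrA addrA subrK.
apply: le_trans (nrmD _ _) _.
have := nrmM_le (h i) (lexx (nrm y)); have := nrmM_le (lexx (nrm x)) (h' i).
have eB : e = e / B * B by rewrite divfK // gt_eqF.
move: (e / B) eB (divr_gt0 e0 B0) {h h'} => t -> t0; rewrite /B.
by have := nrm_ge0 x; have := nrm_ge0 y; nra.
Qed.

Lemma asymp_commutes_sum J (r : seq J) (x : J -> A) :
  (forall j, asymp_commutes (x j)) -> asymp_commutes (\sum_(j <- r) x j).
Proof.
move=> h; elim: r => [|j r IH]; last by rewrite big_cons; exact: asymp_commutesD.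
by apply: (@asymp_commutes_exact _ 0) => k _ i; rewrite big_nil mulr0 mul0r.
Qed.

Lemma asymp_commutes_dense (S : set A) : dense S ->
  (forall y, S y -> asymp_commutes y) -> forall x, asymp_commutes x.
Proof.
move=> dS h x e e0; have e3 : 0 < e / 3 by lra.
have [y Sy xy] := dense_nrm x dS e3; have [m hm] := h y Sy _ e3.
exists m => k mk i.
have -> : E k i * x - x * E k i =
    E k i * (x - y) - (x - y) * E k i + (E k i * y - y * E k i).
  rewrite mulrBr mulrBl opprB.
  by rewrite (AC ((2*2)*2) ((1*4)*((2*5)*(3*6))))/= addNr add0r subrr addr0.
apply: le_trans (nrmD _ _) _; have := hm k mk i.
have := nrmD (E k i * (x - y)) (- ((x - y) * E k i)); rewrite nrmN.
have := nrmM_le (E1 k i) xy; have := nrmM_le xy (E1 k i); lra.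
Qed.

Lemma asymp_commutes_seq (S : seq A) (e : R) :
  (forall x, asymp_commutes x) -> 0 < e ->
  exists k, forall i x, x \in S -> nrm (E k i * x - x * E k i) <= e.
Proof.
move=> h e0.
suff [m hm] : exists m, forall k, (m <= k)%N -> forall i x, x \in S ->
    nrm (E k i * x - x * E k i) <= e by exists m; exact: hm.
elim: S => [|a S [m hm]]; first by exists 0%N.
have [m' hm'] := h a e e0; exists (maxn m m') => k.
rewrite geq_max => /andP[mk mk'] i x; rewrite inE => /predU1P[->|xS].
  exact: hm'.
exact: hm.
Qed.

End Closure.

(** Boundedness of f enters here: it carries commutators from the tensor product
    to A. *)
Lemma asymp_commutes_star_hom (A B : cstarType R) (I : Type)
    (E : nat -> I -> A) (f : A -> B) (x : A) :
  star_hom f -> asymp_commutes E x ->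
  asymp_commutes (fun k i => f (E k i)) (f x).
Proof.
move=> fh cx e e0; have e4 : 0 < e / 4 by lra.
have [m hm] := cx _ e4; exists m => k mk i.
rewrite -!(star_homM fh) -(star_homB fh).
by apply: le_trans (star_hom_bounded fh _) _; have := hm k mk i; lra.
Qed.

Definition mxunits (n : nat) (A : cstarType R) (phi : 'M[R[i]]_n -> A)
  (ij : 'I_n * 'I_n) : A := phi (delta_mx ij.1 ij.2).

Lemma mx_star_hom_comp (n : nat) (A B : cstarType R) (phi : 'M[R[i]]_n -> A)
  (f : A -> B) : mx_star_hom phi -> star_hom f -> mx_star_hom (f \o phi).
Proof.
move=> [pl p1 pM pJ] fh; split=> [c x y|||x] /=.
- by rewrite pl (star_homD fh) (star_homZ fh).
- by rewrite p1 (star_hom1 fh).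
- by move=> x y /=; rewrite pM (star_homM fh).
- by rewrite pJ (star_homJ fh).
Qed.

Lemma mxunits_nrm (n : nat) (A : cstarType R) (phi : 'M[R[i]]_n -> A) ij :
  mx_star_hom phi -> nrm (mxunits phi ij) <= 1.
Proof.
move=> [pl p1 pM pJ]; case: ij => i j; rewrite /mxunits /=.
have J k l : star (phi (delta_mx k l)) = phi (delta_mx l k).
  rewrite -pJ; congr phi; apply/matrixP => a b; rewrite !mxE.
  by rewrite andbC conjC_nat.
have pr : projection (phi (delta_mx j j)).
  by split; [rewrite -pM mul_delta_mx|rewrite J].
have := nrm_cstar (phi (delta_mx i j)); rewrite J -pM mul_delta_mx.
have := nrm_proj_le1 pr; have := nrm_ge0 (phi (delta_mx i j)).
move: (nrm _) (nrm _) => s t; rewrite expr2; nra.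
Qed.

(** A finite tensor involves finitely many factors, and the later ones commute
    with it exactly. *)
Lemma UHF_asymp_commutes (n : nat) (U : cstarType R) : is_UHF n U ->
  exists iota : nat -> 'M[R[i]]_n -> U, (forall k, mx_star_hom (iota k)) /\
    forall x, asymp_commutes (fun k => mxunits (iota k)) x.
Proof.
move=> [iota [ih comm _ dS]]; exists iota; split=> //.
apply: (asymp_commutes_dense _ dS) => [k ij|]; first exact: mxunits_nrm.
move=> _ [m [p [x ->]]]; apply: asymp_commutes_sum => j.
apply: (@asymp_commutes_exact _ _ _ _ m) => k mk ij.
apply: (big_rec (fun y => mxunits (iota k) ij * y = y * mxunits (iota k) ij)).
  by rewrite mulr1 mul1r.
move=> l y _ IH; rewrite mulrA comm; first by rewrite -!mulrA IH.
by move=> kl; have := ltn_ord l; rewrite -kl ltnNge mk.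
Qed.

(** The copies of M_n are the tensor factors of the UHF-algebra far out,
    transported through the tensor product to A. *)
Lemma central_mxunits (n : nat) (A : cstarType R) : absorbs_UHF n A ->
  forall (S : seq A) (e : R), 0 < e -> exists phi : 'M[R[i]]_n -> A,
    mx_star_hom phi /\ forall ij a, a \in S ->
      nrm (mxunits phi ij * a - a * mxunits phi ij) <= e.
Proof.
move=> [U [D [/UHF_asymp_commutes[iota [ih cU]] tD [f [fh [g gK fK]]]]]] S e e0.
have [iA [iB [[iAh iBh iAB _] dS _]]] := tD.
have cD d : asymp_commutes (fun k => mxunits (iB \o iota k)) d.
  apply: (asymp_commutes_dense _ dS) d => [k ij|].
    exact: mxunits_nrm (mx_star_hom_comp (ih k) iBh).
  move=> _ [m [a [b ->]]]; apply: asymp_commutes_sum => j.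
  apply: asymp_commutesM.
    by apply: (@asymp_commutes_exact _ _ _ _ 0) => k _ ij; rewrite /mxunits /= iAB.
  exact: (asymp_commutes_star_hom iBh (cU (b j))).
have cA x : asymp_commutes (fun k => mxunits (f \o (iB \o iota k))) x.
  by rewrite -(fK x); exact: (asymp_commutes_star_hom fh (cD (g x))).
have [k hk] := asymp_commutes_seq S cA e0.
exists (f \o (iB \o iota k)); split=> // .
by apply: mx_star_hom_comp fh; apply: mx_star_hom_comp iBh.
Qed.

End AsymptoticallyCentral.

(** * The projection-valued function on the circle *)

Section RootProjections.
Context {R : realType} (n : nat).
Implicit Types (z : circle R) (k l : 'I_n.+1).

(** The projection p(z) onto the line spanned by (1, z, ..., z^n). *)
Definition root_proj z : 'M[R[i]]_n.+1 :=
  \matrix_(i, j) (n.+1%:R^-1 * zpow z i j).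

Lemma root_proj_conj z : ((root_proj z) ^t* )%sesqui = root_proj z.
Proof.
apply/matrixP => i j; rewrite !mxE rmorphM /= zpow_conj fmorphV /=.
by rewrite rmorph_nat.
Qed.

(** The lines of p(z zeta_k) and p(z zeta_l) are orthogonal for k <> l by
    orthogonality of the characters of the cyclic group. *)
Lemma root_proj_mul z k l :
  root_proj (z * rt k)%g *m root_proj (z * rt l)%g =
  (k == l)%:R *: root_proj (z * rt k)%g.
Proof.
apply/matrixP => i j; rewrite !mxE.
have term m : root_proj (z * rt k)%g i m * root_proj (z * rt l)%g m j =
    n.+1%:R^-1 * n.+1%:R^-1 * zpow z i j * (cval (rt k) ^+ i * (cval (rt l))^-1 ^+ j)
    * (cval (rt m) ^+ l * (cval (rt m))^-1 ^+ k).
  have h1 : zpow z i m * zpow z m j = zpow z i j.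
    by rewrite zpowM (addnC m j) zpow_shift.
  have h2 : cval (rt m) ^+ l = cval (rt l) ^+ m :> R[i]
    by rewrite !rtE -!exprM mulnC.
  have h3 : (cval (rt m))^-1 ^+ k = (cval (rt k))^-1 ^+ m :> R[i].
    by rewrite !rtE !exprVn -!exprM mulnC.
  rewrite !mxE !zpow_mul h2 h3 -h1 /(zpow (rt k)) /(zpow (rt l)).
  move: (zpow z i m) (zpow z m j) (cval (rt k) ^+ i) (_ ^+ m) => a b c d.
  move: (_ ^+ m) (_ ^+ j) n.+1%:R^-1 => e f g; ring.
under eq_bigr => m _ do rewrite term.
rewrite -mulr_sumr rt_sum ?leq_ord // val_eqE eq_sym.
have [->|_] := eqVneq k l; last by rewrite !(mulr0, mul0r).
rewrite mulr1 mul1r zpow_mul -/(zpow (rt l) i j).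
have N0 : n.+1%:R != 0 :> R[i] by rewrite pnatr_eq0.
by move: (zpow z i j) (zpow (rt l) i j) N0; move: n.+1%:R => N a b N0; field.
Qed.

Lemma root_proj_sum z : \sum_(k < n.+1) root_proj (z * rt k)%g = 1%:M.
Proof.
apply/matrixP => i j; rewrite summxE !mxE.
under eq_bigr => k _ do rewrite mxE zpow_mul mulrA.
rewrite -mulr_sumr rt_sum ?leq_ord // val_eqE.
have [->|_] := eqVneq i j; last by rewrite !mulr0.
rewrite mulr1 mulrAC mulVf ?pnatr_eq0 // mul1r.
by have := zpow_shift z 0 0 j; rewrite !add0n => ->; rewrite /zpow mulr1.
Qed.

End RootProjections.

Section EquivariantProjections.
Context {R : realType} {A : cstarType R} (n : nat).
Variable alpha : cstar_action (circle R) A.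
Hypothesis alpha_cont : continuous_action alpha.
Variable phi : 'M[R[i]]_n.+1 -> A.
Hypothesis phi_hom : mx_star_hom phi.
Implicit Types (z : circle R) (k l : 'I_n.+1).

Definition equiv_proj z : A := alpha z^-1%g (phi (root_proj n z)).

Lemma mx_star_homD x y : phi (x + y) = phi x + phi y.
Proof. by have [pl _ _ _] := phi_hom; rewrite -[x]scale1r pl !scale1r. Qed.

Lemma mx_star_hom0 : phi 0 = 0.
Proof. by apply: (@addrI _ (phi 0)); rewrite -mx_star_homD !addr0. Qed.

Lemma mx_star_homZ (c : R[i]) x : phi (c *: x) = c *: phi x.
Proof.
by have [pl _ _ _] := phi_hom; rewrite -[c *: x]addr0 pl mx_star_hom0 addr0.
Qed.

Lemma mx_star_hom_sum (I : Type) (r : seq I) (x : I -> 'M[R[i]]_n.+1) :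
  phi (\sum_(i <- r) x i) = \sum_(i <- r) phi (x i).
Proof. by apply: (big_morph phi); [exact: mx_star_homD|exact: mx_star_hom0]. Qed.

Lemma phi_root_proj z : phi (root_proj n z) =
  \sum_(i < n.+1) \sum_(j < n.+1) (n.+1%:R^-1 * zpow z i j) *: mxunits phi (i, j).
Proof.
rewrite [root_proj n z]matrix_sum_delta mx_star_hom_sum; apply: eq_bigr => i _.
rewrite mx_star_hom_sum; apply: eq_bigr => j _.
by rewrite mx_star_homZ mxE.
Qed.

Lemma approximable_equiv_proj : approximable equiv_proj.
Proof.
have term (i j : 'I_n.+1) := approximableZ (n.+1%:R^-1 : R[i])
  (approximable_zpow i j (approximable_inv
    (approximable_orbit alpha_cont (mxunits phi (i, j))))).
apply: approximable_eq (approximable_sum (index_enum _) (fun i =>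
   approximable_sum (index_enum _) (term i))) => z.
have ah := act_star_hom alpha z^-1%g.
rewrite /equiv_proj phi_root_proj (star_hom_sum ah); apply: eq_bigr => i _.
rewrite (star_hom_sum ah); apply: eq_bigr => j _.
by rewrite (star_homZ ah) scalerA.
Qed.

(** The twist by z^-1 absorbs the action of the root of unity. *)
Lemma equiv_proj_translate k z :
  alpha (rt k) (equiv_proj (z * rt k)%g) = alpha z^-1%g (phi (root_proj n (z * rt k)%g)).
Proof. by rewrite -Defs.actM invMg mulKVg. Qed.

Local Notation P k z := (alpha (rt k) (equiv_proj (z * rt k)%g)).

Lemma translates_mul k l z : P k z * P l z = (k == l)%:R *: P k z.
Proof.
have ah := act_star_hom alpha z^-1%g; have [_ _ pM _] := phi_hom.
by rewrite !equiv_proj_translate -(star_homM ah) -pM root_proj_mul mx_star_homZ (star_homZ ah).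
Qed.

Lemma translates_star k z : star (P k z) = P k z.
Proof.
have ah := act_star_hom alpha z^-1%g; have [_ _ _ pJ] := phi_hom.
by rewrite !equiv_proj_translate -(star_homJ ah) -pJ root_proj_conj.
Qed.

Lemma translates_sum z : \sum_(k < n.+1) P k z = 1.
Proof.
have ah := act_star_hom alpha z^-1%g; have [_ p1 _ _] := phi_hom.
under eq_bigr => k _ do rewrite equiv_proj_translate.
by rewrite -(star_hom_sum ah) -mx_star_hom_sum root_proj_sum p1 (star_hom1 ah).
Qed.

Lemma nrm_natV_le1 : nrm (n.+1%:R^-1 : R[i]) <= 1.
Proof.
have -> : n.+1%:R^-1 = (n.+1%:R^-1 : R)%:C :> R[i] by rewrite fmorphV rmorph_nat.
by rewrite nrm_real ger0_norm ?invr_ge0 // invf_le1 // ler1n.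
Qed.

Lemma translates_comm (a : A) (d : R) :
  (forall ij z, nrm (mxunits phi ij * alpha z a - alpha z a * mxunits phi ij) <= d) ->
  forall k z, nrm (P k z * a - a * P k z) <= 4 * (n.+1%:R * (n.+1%:R * d)).
Proof.
move=> h k z; have ah := act_star_hom alpha z^-1%g.
have aE : a = alpha z^-1%g (alpha z a) by rewrite -Defs.actM mulVg Defs.act1.
rewrite equiv_proj_translate {1 2}aE -!(star_homM ah) -(star_homB ah).
apply: le_trans (act_bounded _ _ _) _; rewrite ler_pM2l //.
rewrite phi_root_proj mulr_suml mulr_sumr -sumrB.
apply: le_trans (nrm_sum _ _ _) _.
have cst (c : R) : n.+1%:R * c = \sum_(i < n.+1) c.
  by rewrite sumr_const card_ord -[RHS]mulr_natl.
rewrite cst; apply: ler_sum => i _; rewrite mulr_suml mulr_sumr -sumrB.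
apply: le_trans (nrm_sum _ _ _) _; rewrite cst; apply: ler_sum => j _.
rewrite csZl csZr -scalerBr nrmZ nrmCM nrm_zpow mulr1 -[d]mul1r.
by apply: ler_pM (h _ _); rewrite ?nrm_ge0 ?nrm_natV_le1.
Qed.

End EquivariantProjections.

(** An orbit of the circle is infinite, but up to a small error it lies in the
    span, with unimodular coefficients, of the coefficients of one Laurent
    polynomial. *)
Lemma orbit_comm (R : realType) (A : cstarType R)
    (alpha : cstar_action (circle R) A) (alpha_cont : continuous_action alpha)
    (S : seq A) (d : R) : 0 < d ->
  exists (S' : seq A) (d' : R), 0 < d' /\ forall e : A, nrm e <= 1 ->
    (forall c, c \in S' -> nrm (e * c - c * e) <= d') ->
    forall a z, a \in S -> nrm (e * alpha z a - alpha z a * e) <= d.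
Proof.
move=> d0; elim: S => [|a S [S' [d' [d'0 IH]]]].
  by exists [::], 1; split.
have d4 : 0 < d / 4 by lra.
have [s hs] := approximable_orbit alpha_cont a d4.
pose S1 := [seq m.2 | m <- s]; pose N : R := (size s)%:R + 1.
have N0 : 0 < N by rewrite /N; have := ler0n R (size s); lra.
have d1 : 0 < d / 2 / N by rewrite !divr_gt0.
exists (S1 ++ S'), (Num.min (d / 2 / N) d'); split; first by rewrite lt_min d1.
move=> e e1 he x z; rewrite inE => /predU1P[->|xS]; last first.
  apply: IH => // c cS'; have : c \in S1 ++ S' by rewrite mem_cat cS' orbT.
  by move=> /he; rewrite le_min => /andP[].
have {}he c : c \in S1 -> nrm (e * c - c * e) <= d / 2 / N.
  move=> cS; have : c \in S1 ++ S' by rewrite mem_cat cS.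
  by move=> /he; rewrite le_min => /andP[].
set G := ev_circ s z.
have -> : e * alpha z a - alpha z a * e =
    e * (alpha z a - G) - (alpha z a - G) * e + (e * G - G * e).
  rewrite mulrBr mulrBl opprB.
  by rewrite (AC ((2*2)*2) ((1*4)*((2*5)*(3*6))))/= addNr add0r subrr addr0.
have Gc : nrm (e * G - G * e) <= d / 2.
  rewrite /G /ev_circ mulr_sumr mulr_suml -sumrB.
  apply: le_trans (nrm_sum _ _ _) _.
  apply: (@le_trans _ _ (\sum_(m <- s) d / 2 / N)).
    rewrite big_seq [leRHS]big_seq; apply: ler_sum => m ms.
    rewrite csZl csZr -scalerBr nrmZ nrm_zpow mul1r; apply: he.
    exact: map_f.
  rewrite big_const_seq count_predT iter_addr_0 -[leLHS]mulr_natl.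
  have d2 : 0 <= d / 2 by lra.
  by rewrite mulrCA ler_piMr // ler_pdivrMr // mul1r /N lerDl.
apply: le_trans (nrmD _ _) _.
have := nrmD (e * (alpha z a - G)) (- ((alpha z a - G) * e)); rewrite nrmN.
have := nrmM_le e1 (hs z); have := nrmM_le (hs z) e1; rewrite -/G; lra.
Qed.

(** * Rokhlin projections for the cyclic group *)

Section Assembly.
Context {R : realType} {A : cstarType R}.
Variable alpha : cstar_action (circle R) A.
Hypothesis alpha_cont : continuous_action alpha.
Hypothesis alpha_rokhlin : rokhlin_circle alpha.
Local Existing Instance rokhlin_unitaries_filter.
Local Notation F := (rokhlin_unitaries alpha).

Lemma near_seq (T : eqType) (S : seq T) (P : T -> set A) :
  (forall a, a \in S -> \forall u \near F, P a u) ->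
  \forall u \near F, forall a, a \in S -> P a u.
Proof.
elim: S => [|a S IH] h; first exact: filterE.
have h1 : \forall u \near F, P a u by apply: h; rewrite mem_head.
have h2 : \forall u \near F, forall a, a \in S -> P a u.
  by apply: IH => b bS; apply: h; rewrite inE bS orbT.
apply: filterS2 h1 h2 => u Pa PS b; rewrite inE => /predU1P[->|] //.
exact: PS.
Qed.

Lemma deg_le_ex (s : seq (nat * nat * A)) : exists D, deg_le D s.
Proof.
elim: s => [|m s [D hD]]; first by exists 0%N.
exists (maxn D (m.1.1 + m.1.2)); apply/andP; split.
  by rewrite !leq_max leq_addr leq_addl !orbT.
by apply: sub_all hD => x /andP[h h']; rewrite !leq_max h h'.
Qed.

Lemma nrm_le_sum (S : seq A) a : a \in S -> nrm a <= \sum_(b <- S) nrm b.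
Proof.
move=> aS; rewrite (big_rem a aS) /= lerDl; apply: sumr_ge0 => b _.
exact: nrm_ge0.
Qed.

Lemma rt_mul n (k l : 'I_n.+1) : rt (k * l)%g = (rt k * rt l)%g :> circle R.
Proof. exact: (@nth_rootM R n.+1). Qed.

(** The perturbation lemma wants self-adjoint elements, and the value of a
    Laurent polynomial at u is only almost self-adjoint even if the polynomial
    has self-adjoint values on the circle. *)
Definition sa_part (x : A) : A := (2^-1 : R[i]) *: (x + star x).

Lemma star_sa_part x : star (sa_part x) = sa_part x.
Proof. by rewrite /sa_part starZ half_conj starD starK addrC. Qed.

Lemma sa_partB x y : sa_part x - sa_part y = sa_part (x - y).
Proof. by rewrite /sa_part -scalerBr starB opprD addrACA. Qed.

Lemma sa_part_id x : star x = x -> sa_part x = x.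
Proof. by rewrite /sa_part => ->; exact: halfD. Qed.

Lemma nrm_sa_part x : nrm (sa_part x) <= nrm x.
Proof. by rewrite nrm_halfZ; have := nrmD x (star x); rewrite nrm_star; lra. Qed.

Lemma star_hom_sa_part (B : cstarType R) (f : A -> B) x : star_hom f ->
  f (sa_part x) = (2^-1 : R[i]) *: (f x + star (f x)).
Proof. by move=> fh; rewrite (star_homZ fh) (star_homD fh) (star_homJ fh). Qed.

Section Model.
Variables (n : nat) (P : circle R -> A) (s : seq (nat * nat * A)) (d : R).
Hypothesis d01 : 0 < d <= 4^-1.
Hypothesis sP : forall z, nrm (P z - ev_circ s z) <= d.
Implicit Types (k l : 'I_n.+1) (z : circle R).
Local Notation Pk k z := (alpha (rt k) (P (z * rt k)%g)).
Hypothesis PM : forall k l z, Pk k z * Pk l z = (k == l)%:R *: Pk k z.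
Hypothesis PJ : forall k z, star (Pk k z) = Pk k z.
Hypothesis P1 : forall z, \sum_(k < n.+1) Pk k z = 1.

(** The symbol of [tower k], close to the k-th translate of P and hence, at each
    point of the circle, to an exact projection. *)
Definition model k z : A := sa_part (ev_circ (rotate alpha (rt k) s) z).
Definition tower k (u : A) : A := sa_part (ev_at (rotate alpha (rt k) s) u).

Lemma tower_symbol : exists D, forall k, symbol alpha D (model k) (tower k).
Proof.
have [D sD] := deg_le_ex s; exists D => k.
have h := symbol_ev alpha (deg_le_rotate alpha (rt k) sD).
exact: symbolZ (symbolD h (symbolJ h)).
Qed.

Lemma Pk_nrm k z : nrm (Pk k z) <= 1.
Proof.
by apply: nrm_proj_le1; split; [rewrite PM eqxx scale1r|exact: PJ].
Qed.

Lemma model_near k z : nrm (model k z - Pk k z) <= 4 * d.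
Proof.
rewrite -[Pk k z]sa_part_id // sa_partB; apply: le_trans (nrm_sa_part _) _.
rewrite ev_circ_rotate -(star_homB (act_star_hom alpha _)).
apply: le_trans (act_bounded _ _ _) _; rewrite ler_pM2l // nrmB; exact: sP.
Qed.

Lemma model_nrm k z : nrm (model k z) <= 2.
Proof.
have := nrm_le_sub (model k z) (Pk k z); have := model_near k z.
by have := Pk_nrm k z; case/andP: d01; lra.
Qed.

Lemma model_mul k l z :
  nrm (model k z * model l z - (k == l)%:R *: model k z) <= 16 * d.
Proof.
have -> : model k z * model l z - (k == l)%:R *: model k z =
    (model k z - Pk k z) * model l z + Pk k z * (model l z - Pk l z)
    - (k == l)%:R *: (model k z - Pk k z).
  by rewrite mulrBl mulrBr PM scalerBr opprB subrKA subrKA.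
apply: le_trans (nrmD _ _) _; rewrite nrmN nrmZ.
have := nrmD ((model k z - Pk k z) * model l z) (Pk k z * (model l z - Pk l z)).
have := nrmM_le (model_near k z) (model_nrm l z).
have := nrmM_le (Pk_nrm k z) (model_near l z).
have : nrm ((k == l)%:R : R[i]) * nrm (model k z - Pk k z) <= 1 * (4 * d).
  apply: ler_pM; rewrite ?nrm_ge0 ?model_near //.
  by case: eqP => _; rewrite ?nrm1C // nrm0.
lra.
Qed.

Lemma model_sum z : nrm (\sum_(k < n.+1) model k z - 1) <= n.+1%:R * (4 * d).
Proof.
rewrite -(P1 z) -sumrB; apply: le_trans (nrm_sum _ _ _) _.
have -> : n.+1%:R * (4 * d) = \sum_(k < n.+1) 4 * d.
  by rewrite sumr_const card_ord -[RHS]mulr_natl.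
by apply: ler_sum => k _; exact: model_near.
Qed.

Lemma model_comm (a : A) (c : R) k z : nrm (Pk k z * a - a * Pk k z) <= c ->
  nrm (model k z * a - a * model k z) <= 8 * d * nrm a + c.
Proof.
move=> Pc; set p := Pk k z in Pc *.
have -> : model k z * a - a * model k z =
    (model k z - p) * a - a * (model k z - p) + (p * a - a * p).
  rewrite mulrBl mulrBr opprB.
  by rewrite (AC ((2*2)*2) ((1*4)*((2*5)*(3*6))))/= addNr add0r subrr addr0.
apply: le_trans (nrmD _ _) _.
have := nrmD ((model k z - p) * a) (- (a * (model k z - p))); rewrite nrmN.
have := nrmM_le (model_near k z) (lexx (nrm a)).
have := nrmM_le (lexx (nrm a)) (model_near k z).
by rewrite -/p; lra.
Qed.

Lemma near_tower_mul (e : R) : 17 * d <= e -> \forall u \near F, forall k l,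
  nrm (tower k u * tower l u - (k == l)%:R *: tower k u) <= e.
Proof.
move=> de; have /andP[d0 _] := d01; have [D sD] := tower_symbol.
apply: filter_forall => k; apply: filter_forall => l.
have h := symbolB (symbolM (sD k) (sD l))
  (symbol_leq (leq_addr D D) (symbolZ (k == l)%:R (sD k))).
have d16 : 0 <= 16 * d by lra.
apply: filterS (symbol_norm h d16 d0 (model_mul k l)) => u; lra.
Qed.

Lemma near_tower_sum (e : R) : n.+1%:R * (4 * d) + d <= e ->
  \forall u \near F, nrm (\sum_(k < n.+1) tower k u - 1) <= e.
Proof.
move=> de; have /andP[d0 _] := d01; have [D sD] := tower_symbol.
have h := symbolB (symbol_sum (index_enum _) sD) (symbol_cst alpha D 1).
have d4 : 0 <= n.+1%:R * (4 * d) by rewrite mulr_ge0 //; lra.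
apply: filterS (symbol_norm h d4 d0 model_sum) => u; lra.
Qed.

Lemma near_tower_comm (S : seq A) (c e : R) : 0 <= c ->
  (forall a, a \in S -> forall k z, nrm (Pk k z * a - a * Pk k z) <= c) ->
  (forall a, a \in S -> 8 * d * nrm a + c + d <= e) ->
  \forall u \near F, forall a, a \in S -> forall k,
    nrm (tower k u * a - a * tower k u) <= e.
Proof.
move=> c0 Pc ce; have /andP[d0 _] := d01; have [D sD] := tower_symbol.
apply: near_seq => a aS; apply: filter_forall => k.
have ca := symbol_cst alpha D a.
have h := symbolB (symbolM (sD k) ca) (symbolM ca (sD k)).
have b0 : 0 <= 8 * d * nrm a + c by rewrite addr_ge0 // !mulr_ge0 ?nrm_ge0 //; lra.
have hb z := model_comm (Pc a aS k z).
by apply: filterS (symbol_norm h b0 d0 hb) => u; have := ce a aS; lra.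
Qed.

Lemma near_tower_act (e : R) : 0 < e -> \forall u \near F, forall g k,
  nrm (alpha (rt g) (tower k u) - tower (g * k)%g u) <= e.
Proof.
move=> e0; apply: filter_forall => g; apply: filter_forall => k.
have := vanish_act_ev_at alpha (rt g) (rotate alpha (rt k) s).
move=> /(_ e e0); apply: filterS => u h.
rewrite /tower star_hom_sa_part; last exact: act_star_hom.
by rewrite rt_mul rotateM sa_partB; apply: le_trans (nrm_sa_part _) h.
Qed.

End Model.

(** The tolerances are fixed in the order: d0 for [partition_near], then d for
    the Laurent approximation, then c for the commutators with the matrix units;
    the unitary u comes last. *)
Lemma rokhlin_towers n (S : seq A) (eps : R) : absorbs_UHF n.+1 A -> 0 < eps ->
  exists e : 'I_n.+1 -> A,
    [/\ (forall k, projection (e k)) /\ (forall k l, k <> l -> e k * e l = 0),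
        forall g k, nrm (alpha (rt g) (e k) - e (g * k)%g) < eps,
        forall k a, a \in S -> nrm (e k * a - a * e k) < eps &
        \sum_k e k = 1].
Proof.
move=> absU eps0; pose B := \sum_(b <- S) nrm b.
have B0 : 0 <= B by apply: sumr_ge0 => b _; exact: nrm_ge0.
have B16 : 0 < 16 * (B + 1) by lra.
pose eps1 := eps / (16 * (B + 1)).
have eps10 : 0 < eps1 by rewrite divr_gt0.
have eps1E : eps = 16 * (eps1 * B) + 16 * eps1.
  by rewrite -{1}[eps](divfK (lt0r_neq0 B16)) -/eps1; lra.
have [d0 d00 hd0] := @partition_near R A n.+1 eps1 eps10.
have N1 : 1 <= n.+1%:R :> R by rewrite ler1n.
have N0 : 0 < n.+1%:R :> R by rewrite ltr0n.
pose d := Num.min 4^-1 (Num.min (d0 / (17 * n.+1%:R)) (eps1 / 4)).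
have N17 : 0 < 17 * n.+1%:R :> R by rewrite mulr_gt0.
have d_gt0 : 0 < d.
  by rewrite !lt_min (divr_gt0 d00 N17); apply/and3P; split=> //; lra.
have d01 : 0 < d <= 4^-1 by rewrite d_gt0 ge_min lexx.
have d_eps : d <= eps1 / 4 by rewrite !ge_min lexx !orbT.
have d_d0 : 17 * (d * n.+1%:R) <= d0.
  have : d <= d0 / (17 * n.+1%:R) by rewrite !ge_min lexx orbT.
  by rewrite ler_pdivlMr // mulrCA.
have dn : d <= d * n.+1%:R by rewrite ler_peMr // ltW.
pose c := d / (4 * (n.+1%:R * n.+1%:R)).
have c0 : 0 < c by rewrite divr_gt0 // !mulr_gt0.
have [S' [d' [d'0 hS']]] := orbit_comm alpha_cont S c0.
have [phi [phiH phiC]] := central_mxunits absU S' d'0.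
have [s hs] := approximable_equiv_proj alpha_cont phiH d_gt0.
have PM := translates_mul alpha phiH; have PJ := translates_star alpha phiH.
have P1 := translates_sum alpha phiH.
have Pc a : a \in S -> forall (k : 'I_n.+1) z,
    nrm (alpha (rt k) (equiv_proj alpha phi (z * rt k)%g) * a -
         a * alpha (rt k) (equiv_proj alpha phi (z * rt k)%g)) <= d.
  move=> aS k z.
  have dE : 4 * (n.+1%:R * (n.+1%:R * c)) = d.
    have N4 : 4 * (n.+1%:R * n.+1%:R) != 0 :> R by rewrite lt0r_neq0 ?mulr_gt0.
    by rewrite -[RHS](divfK N4) -/c; lra.
  have Cc ij w : nrm (mxunits phi ij * alpha w a - alpha w a * mxunits phi ij) <= c.
    exact: hS' (mxunits_nrm ij phiH) (phiC ij) _ _ aS.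
  by have := translates_comm phiH Cc k z; rewrite dE.
have hm : 17 * d <= d0 by apply: le_trans d_d0; rewrite ler_pM2l.
have hsum : n.+1%:R * (4 * d) + d <= d0 by lra.
have hc a : a \in S -> 8 * d * nrm a + d + d <= eps / 4.
  move=> aS; have h : d * nrm a <= eps1 / 4 * B.
    exact: ler_pM (ltW d_gt0) (nrm_ge0 a) d_eps (nrm_le_sum aS).
  lra.
have eps4 : 0 < eps / 4 by lra.
have [u [[Tmul Tsum] [Tcomm Tact]]] := rokhlin_unitaries_ex alpha_rokhlin
  (filterI
    (filterI (near_tower_mul d01 hs PM PJ hm) (near_tower_sum d01 hs PJ P1 hsum))
    (filterI (near_tower_comm d01 hs PJ (ltW d_gt0) Pc hc)
      (@near_tower_act n s _ eps4))).
pose h i := @tower n s (inord i) u.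
have [||e [[ep eo] e1 eh]] := hd0 h.
- split=> [k _|k l kn ln]; first exact: star_sa_part.
  by have := Tmul (inord k) (inord l); rewrite -val_eqE /= !inordK.
- by under eq_bigr => i _ do rewrite /h inord_val.
have {}eh (k : 'I_n.+1) : nrm (e k - tower s k u) <= eps1.
  by have := eh k (ltn_ord k); rewrite /h inord_val.
exists (fun k : 'I_n.+1 => e k); split=> //.
- split=> [k|k l kl]; first exact: ep.
  by apply: eo => //; apply/eqP => /val_inj.
- move=> g k; have ah := act_star_hom alpha (rt g).
  apply: le_lt_trans (nrm_sub_trans (alpha (rt g) (tower s k u)) _ _) _.
  rewrite -(star_homB ah).
  have := nrm_sub_trans (tower s (g * k)%g u) (alpha (rt g) (tower s k u)) (e (g * k)%g).
  have := act_bounded alpha (rt g) (e k - tower s k u).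
  have := eh k; have := Tact g k; have := eh (g * k)%g.
  rewrite [nrm (e (g * k)%g - tower _ _ _)]nrmB.
  have : 0 <= eps1 * B by rewrite mulr_ge0 // ltW.
  lra.
- move=> k a aS; pose t := tower s k u.
  have -> : e k * a - a * e k = (e k - t) * a - a * (e k - t) + (t * a - a * t).
    rewrite mulrBl mulrBr opprB.
    by rewrite (AC ((2*2)*2) ((1*4)*((2*5)*(3*6))))/= addNr add0r subrr addr0.
  apply: le_lt_trans (nrmD _ _) _.
  have := nrmD ((e k - t) * a) (- (a * (e k - t))); rewrite nrmN.
  have := nrmM_le (eh k) (nrm_le_sum aS); have := nrmM_le (nrm_le_sum aS) (eh k).
  have := Tcomm a aS k; rewrite -/t -/B; lra.
Qed.

End Assembly.

Theorem theorem3p19 (R : realType) (A : cstarType R)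
    (sepA : separable_space A)
    (n : nat) (n_gt0 : (0 < n)%N)
    (alpha : cstar_action (circle R) A)
    (alpha_cont : continuous_action alpha)
    (alpha_rokhlin : rokhlin_circle alpha)
    (A_absorbs : absorbs_UHF n A) :
  rokhlin_finite (restrict_Zn n alpha).
Proof.
case: n n_gt0 A_absorbs => // n _ absU F eps /finite_seqP[S ->] eps0.
have epsE : eps = (complex.Re eps)%:C by rewrite RRe_real // gtr0_real.
have epsR : 0 < complex.Re eps by rewrite -ltcR -epsE.
have [e [e1 e2 e3 e4]] := rokhlin_towers alpha_cont alpha_rokhlin S absU epsR.
exists e; split=> // [g h|g a aS]; rewrite epsE nrmE ltcR; first exact: e2.
exact: e3.
Qed.
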